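(* Let $0<\gamma<2$, $\gamma\neq4/3$, and assume $V$ and $\chi$ are positive functions of class $C^3$ on $\mathbb{R}$. For $p\in\Sigma$ let $O^-(p)$ be the past orbit of $p$ under the flow of the system $(\ast)$ (see context). Then for almost all $p\in\Sigma$ (i.e. outside a subset of $\Sigma$ of measure zero with respect to the natural 3-dimensional measure on $\Sigma$), the scalar field $\phi$ is unbounded on $O^-(p)$.
   Context: The system $(\ast)$ is the autonomous system (prime $=d/d\tau$): $x'=\tfrac12 x(2y^2+\gamma z^2)$; $y'=y^3+\tfrac12(\gamma z^2-2)y-\frac{x^2V'(\phi)}{3\sqrt6}+\frac{(4-3\gamma)z^2}{2\sqrt6}\frac{\chi'(\phi)}{\chi(\phi)}$; $z'=\tfrac12 z(2y^2+(z^2-1)\gamma)-\frac{(4-3\gamma)yz}{2\sqrt6}\frac{\chi'(\phi)}{\chi(\phi)}$; $\phi'=\sqrt{2/3}\,y$, on the state space $\Sigma=\{(x,y,z,\phi)\in\mathbb{R}^4: x\ge0,\ z\ge0,\ y^2+z^2+\tfrac13x^2V(\phi)=1\}$ (a 3-dimensional set). *)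

(* Defs.v *)
From Stdlib Require Import Reals.
Open Scope R_scope.

Definition C3 (f f1 f2 f3 : R -> R) : Prop :=
  (forall t, derivable_pt_lim f t (f1 t)) /\
  (forall t, derivable_pt_lim f1 t (f2 t)) /\
  (forall t, derivable_pt_lim f2 t (f3 t)) /\
  continuity f3.

Definition in_Sigma (V : R -> R) (x y z ph : R) : Prop :=
  0 <= x /\ 0 <= z /\ y ^ 2 + z ^ 2 + (1/3) * x ^ 2 * V ph = 1.

(* Right-hand sides of system (ast); V1 = V', chi1 = chi'. *)
Definition Fx (g : R) (x y z ph : R) : R :=
  (1/2) * x * (2 * y ^ 2 + g * z ^ 2).
Definition Fy (g : R) (V1 chi chi1 : R -> R) (x y z ph : R) : R :=
  y ^ 3 + (1/2) * (g * z ^ 2 - 2) * y - x ^ 2 * V1 ph / (3 * sqrt 6)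
  + (4 - 3 * g) * z ^ 2 / (2 * sqrt 6) * (chi1 ph / chi ph).
Definition Fz (g : R) (chi chi1 : R -> R) (x y z ph : R) : R :=
  (1/2) * z * (2 * y ^ 2 + (z ^ 2 - 1) * g)
  - (4 - 3 * g) * y * z / (2 * sqrt 6) * (chi1 ph / chi ph).
Definition Fph (x y z ph : R) : R := sqrt (2/3) * y.

Definition left_lim (f : R -> R) (a l : R) : Prop :=
  forall eps, 0 < eps -> exists d, 0 < d /\
    forall tau, a - d < tau < a -> Rabs (f tau - l) < eps.

Definition solves (g : R) (V1 chi chi1 : R -> R) (X Y Z P : R -> R)
  (t0 t1 : R) : Prop :=
  forall tau, t0 < tau < t1 ->
    derivable_pt_lim X tau (Fx g (X tau) (Y tau) (Z tau) (P tau)) /\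
    derivable_pt_lim Y tau (Fy g V1 chi chi1 (X tau) (Y tau) (Z tau) (P tau)) /\
    derivable_pt_lim Z tau (Fz g chi chi1 (X tau) (Y tau) (Z tau) (P tau)) /\
    derivable_pt_lim P tau (Fph (X tau) (Y tau) (Z tau) (P tau)).

(* phi is unbounded on the past orbit O^-(p) of p = (x0,y0,z0,ph0):
   for every bound M there is a backward solution through p, i.e. a solution
   on (t,0) tending to p as tau -> 0^-, reaching a time t' in (t,0) with
   |phi(t')| > M.  (By uniqueness of solutions, every such backward solution
   is a piece of the maximal one, so this is exactly unboundedness of phi
   on the past orbit.) *)
Definition phi_unbounded_past (g : R) (V1 chi chi1 : R -> R)
  (x0 y0 z0 ph0 : R) : Prop :=
  forall M : R, exists (t t' : R) (X Y Z P : R -> R),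
    t < t' < 0 /\
    solves g V1 chi chi1 X Y Z P t 0 /\
    left_lim X 0 x0 /\ left_lim Y 0 y0 /\ left_lim Z 0 z0 /\ left_lim P 0 ph0 /\
    M < Rabs (P t').

(* N has 3-dimensional (spherical) Hausdorff measure zero in R^4:
   for every eps > 0, N is covered by countably many Euclidean balls
   B(c_n, r_n) with sum r_n^3 < eps. *)
Definition H3_null (N : R -> R -> R -> R -> Prop) : Prop :=
  forall eps, 0 < eps ->
    exists (cx cy cz cp r : nat -> R),
      (forall n, 0 < r n) /\
      (forall n, sum_f_R0 (fun k => r k ^ 3) n < eps) /\
      (forall x y z ph, N x y z ph -> exists n,
         (x - cx n) ^ 2 + (y - cy n) ^ 2 + (z - cz n) ^ 2 + (ph - cp n) ^ 2
           < r n ^ 2).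

(* Main.v *)
(** The constraint is parametrised by [y = tanh s], [z = sech s * ls q] and
    [x = sqrt (3 / V phi) * sech s * lc q], where [ls q] and [lc q] are the sine
    and cosine of the angle of tangent [exp q].  In the coordinates
    [(s, q, phi)] only the first component of the field depends on its own
    variable, and the divergence is
    [- (1 - y^2) (1 - (g / 2) (ls q)^2) <= 0].  It degenerates only where [y^2]
    is close to 1, but there [y phi] grows along orbits; hence, on
    [|phi| <= M], the volume weighted by [exp (- d * y * phi)] is contracted at
    a uniform exponential rate.  The points having a past orbit in
    [|phi| <= M] and bounded [(s, q)] are images, under the flow during time
    [T], of points of a box whose size grows linearly in [T], so their volume
    is at most [exp (- c T)] times a cubic polynomial in [T], for every [T].

    Contraction is proved on finite covers by cubes: over a short time [h] the
    flow is, up to errors of size [h^2] relative to the cube, a composition of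
    three maps each changing one coordinate, and such a map only shears and
    stretches the columns of a finely subdivided cube. *)

Require Import Defs.
From Stdlib Require Import Reals Lra Lia Psatz List Classical.
From Stdlib Require Import IndefiniteDescription Cantor FinFun.
From Coquelicot Require Import Coquelicot.
Open Scope R_scope.

(** * Covers by cubes *)

(** Covers are attached to families of trajectories rather than to point sets: a family is covered
    by its positions at one instant, and the cover is carried from parameter [T], in the far past,
    to parameter 0. The direction matters: volume contracts forward in time, so a crude cover of a
    large box in the past turns into a cover of the present positions with tiny total volume. The
    step [h] does not tend to 0. One step multiplies the weighted volume by
    [exp (- c0 * h + D * h ^ 2)], so a fixed [h] with [D * h <= c0 / 2] keeps half of the rate, and
    only the number of steps grows. Every error must therefore be relative to the side of the cube,
    however small it has become; this is why two orbits are always compared with each other. The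
    chart [(s, q, phi)] leaves out the faces [x = 0] and [z = 0] of the state space. They are
    surfaces, parametrised by an angle and [phi], hence null whatever their dynamics. The remaining
    points are exhausted by countably many sets of bounded coordinates, on each of which the
    parametrisation is Lipschitz. *)

Definition cube := (R * R * R)%type.

Definition in_cube (e : R) (k : cube) (x y z : R) : Prop :=
  let '(a, b, c) := k in
  a <= x <= a + e /\ b <= y <= b + e /\ c <= z <= c + e.

(** Indexed by a family [U] with three coordinate functions, so that the coordinates of one
    trajectory may be read at different instants: the intermediate covers of [one_step] mix [t1] and
    [t2]. *)
Definition covers {U : Type} (P : U -> Prop) (a b c : U -> R) (e : R)
  (l : list cube) : Prop :=
  forall u, P u -> exists k, In k l /\ in_cube e k (a u) (b u) (c u).

Fixpoint wsum {I : Type} (w : I -> R) (l : list I) : R :=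
  match l with nil => 0 | i :: l' => w i + wsum w l' end.

Lemma wsum_app {I} (w : I -> R) l1 l2 :
  wsum w (l1 ++ l2) = wsum w l1 + wsum w l2.
Proof. induction l1 as [|i l1 IH]; simpl; [ring | rewrite IH; ring]. Qed.

Lemma wsum_const {I} (r : R) (l : list I) :
  wsum (fun _ => r) l = INR (length l) * r.
Proof.
induction l as [|i l IH]; cbn [wsum length]; [simpl; ring|].
rewrite IH, S_INR; ring.
Qed.

Lemma wsum_le {I} (w w' : I -> R) l :
  (forall i, In i l -> w i <= w' i) -> wsum w l <= wsum w' l.
Proof.
induction l as [|i l IH]; simpl; intros H; [lra|].
apply Rplus_le_compat; auto.
Qed.

Lemma covers_weaken {U} (P Q : U -> Prop) a b c e l :
  (forall u, Q u -> P u) -> covers P a b c e l -> covers Q a b c e l.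
Proof. intros H HP u Hu; apply HP, H, Hu. Qed.

(** The budget of a piece is proportional to its own weight, so budgets add up. The pieces are grid
    cells in one use and the cubes of an earlier cover in others. *)
Lemma cover_union {U I} (P : U -> Prop) (Q : I -> U -> Prop) a b c e
  (w : I -> R) (w' : cube -> R) r (l : list I) :
  (forall i, In i l -> exists l', covers (fun u => P u /\ Q i u) a b c e l' /\
     wsum w' l' <= r * w i) ->
  exists l', covers (fun u => P u /\ exists i, In i l /\ Q i u) a b c e l' /\
     wsum w' l' <= r * wsum w l.
Proof.
induction l as [|i l IH]; intros H.
- exists nil; split; [intros u [_ [i [[] _]]] | simpl; lra].
- destruct IH as [l1 [C1 S1]]; [intros j Hj; apply H; now right|].
  destruct (H i) as [l2 [C2 S2]]; [now left|].
  exists (l2 ++ l1); split.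
  + intros u [Pu [j [[<-|Hj] Qj]]].
    * destruct (C2 u) as [k [Hk Hk']]; [tauto|].
      exists k; split; [apply in_or_app; now left | easy].
    * destruct (C1 u) as [k [Hk Hk']]; [split; [easy|now exists j]|].
      exists k; split; [apply in_or_app; now right | easy].
  + rewrite wsum_app; simpl; lra.
Qed.

(** The weight of a cube can be estimated only through a trajectory that visits it, so unvisited
    cubes have to be discarded. The induction removes from [P] what the first cube already
    covers. *)
Lemma cover_prune {U} (P : U -> Prop) a b c e (w : cube -> R) l :
  (forall k, 0 <= w k) -> covers P a b c e l ->
  exists l', covers P a b c e l' /\ wsum w l' <= wsum w l /\
    forall k, In k l' -> exists u, P u /\ in_cube e k (a u) (b u) (c u).
Proof.
intros Hw; revert P.
induction l as [|k l IH]; intros P C.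
- exists nil; repeat split; [exact C | simpl; lra | intros k []].
- destruct (IH (fun u => P u /\ ~ in_cube e k (a u) (b u) (c u)))
    as [l' [C' [S' N']]].
  { intros u [Pu Nu]; destruct (C u Pu) as [k' [[<-|Hk] Hi]]; [easy|now exists k']. }
  destruct (classic (exists u, P u /\ in_cube e k (a u) (b u) (c u))) as [Y|N].
  + exists (k :: l'); repeat split.
    * intros u Pu; destruct (classic (in_cube e k (a u) (b u) (c u))) as [Hi|Hi].
      -- exists k; split; [now left | easy].
      -- destruct (C' u) as [k' [? ?]]; [easy|]; exists k'; split; [now right|easy].
    * simpl; lra.
    * intros k' [<-|Hk]; [easy|].
      destruct (N' k' Hk) as [u [[Pu _] Hu]]; now exists u.
  + exists l'; repeat split.
    * intros u Pu; apply C'; split; [easy|]; intros Hi; apply N; now exists u.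
    * specialize (Hw k); simpl; lra.
    * intros k' Hk; destruct (N' k' Hk) as [u [[Pu _] Hu]]; now exists u.
Qed.

Lemma grid_index (x y e : R) (n : nat) : (0 < n)%nat ->
  y <= x <= y + INR n * e ->
  exists i, (i < n)%nat /\ y + INR i * e <= x <= y + INR i * e + e.
Proof.
induction n as [|n IH]; intros Hn Hx; [lia|].
rewrite S_INR in Hx.
destruct (Rle_dec (y + INR n * e) x) as [H|H].
- exists n; split; [lia | lra].
- destruct n as [|n]; [simpl in H; lra|].
  destruct IH as [i [Hi Hi']]; [lia | lra |]; exists i; split; [lia | lra].
Qed.

(* A column of cross-section [e * e] along which [a1] oscillates by at most
   [m * e] needs only [m] cubes, however the column has been sheared. *)
Lemma column_cover {U} (P : U -> Prop) (a1 b c : U -> R) (y z e : R)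
  (n m : nat) : (0 < n)%nat -> (0 < m)%nat ->
  (forall u, P u -> y <= b u <= y + INR n * e /\ z <= c u <= z + INR n * e) ->
  (forall u v, P u -> P v -> Rabs (b u - b v) <= e -> Rabs (c u - c v) <= e ->
     a1 u - a1 v <= INR m * e) ->
  exists l, covers P b c a1 e l /\
    wsum (fun _ => 1) l <= INR m * (INR n * INR n).
Proof.
intros Hn Hm Hb Hosc.
destruct (cover_union P
  (fun ij u => y + INR (fst ij) * e <= b u <= y + INR (fst ij) * e + e /\
               z + INR (snd ij) * e <= c u <= z + INR (snd ij) * e + e)
  b c a1 e (fun _ => 1) (fun _ => 1) (INR m)
  (list_prod (seq 0 n) (seq 0 n))) as [l [C S]].
2:{ exists l; split.
    - refine (covers_weaken _ _ _ _ _ _ _ _ C).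
      intros u Pu; split; [easy|].
      destruct (Hb u Pu) as [H1 H2].
      destruct (grid_index _ _ _ _ Hn H1) as [i [Hi ?]].
      destruct (grid_index _ _ _ _ Hn H2) as [j [Hj ?]].
      exists (i, j); split; [|now split].
      apply in_prod; apply in_seq; lia.
    - rewrite (wsum_const 1 (list_prod _ _)), length_prod, length_seq, mult_INR in S.
      lra. }
intros [i j] _; cbn [fst snd].
set (Q := fun u => P u /\ _ /\ _).
destruct (classic (exists u, Q u)) as [[u0 Q0]|N].
2:{ exists nil; split; [intros u Qu; exfalso; apply N; now exists u|].
    pose proof (pos_INR m); simpl; lra. }
assert (osc : forall u v, Q u -> Q v -> a1 u - a1 v <= INR m * e).
{ intros u v [Pu [Hu Hu']] [Pv [Hv Hv']]; apply Hosc; auto;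
  apply Rabs_le; lra. }
(* The supremum [s] of [- a1] is minus the lowest level reached by [a1] in this cell; the stack of
   [m] cubes starts at [- s]. *)
destruct (completeness (fun r => exists u, Q u /\ r = - a1 u)) as [s [Hs1 Hs2]].
{ exists (INR m * e - a1 u0); intros r [u [Qu ->]].
  specialize (osc u0 u Q0 Qu); lra. }
{ now exists (- a1 u0), u0. }
exists (map (fun t => (y + INR i * e, z + INR j * e, - s + INR t * e)) (seq 0 m)).
split.
- intros u Qu.
  destruct (grid_index (a1 u) (- s) e m Hm) as [t [Ht Ht']].
  { assert (- a1 u <= s) by (apply Hs1; now exists u).
    assert (s <= INR m * e - a1 u); [|lra].
    apply Hs2; intros r [v [Qv ->]]; specialize (osc u v Qu Qv); lra. }
  exists (y + INR i * e, z + INR j * e, - s + INR t * e); split.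
  + apply in_map_iff; exists t; split; [easy|apply in_seq; lia].
  + destruct Qu as [_ [H1 H2]]; repeat split; try apply H1; try apply H2; apply Ht'.
- rewrite wsum_const, length_map, length_seq; lra.
Qed.

(** * The reduced vector field and pairs of orbits *)

Lemma cosh_pos s : 0 < cosh s.
Proof. unfold cosh; pose proof (exp_pos s); pose proof (exp_pos (- s)); lra. Qed.

Lemma cosh_sinh_sq s : cosh s ^ 2 - sinh s ^ 2 = 1.
Proof.
unfold cosh, sinh.
assert (exp s * exp (- s) = 1) by (rewrite <- exp_plus, Rplus_opp_r; apply exp_0).
nra.
Qed.

Lemma sech_tanh_sq s : (/ cosh s) ^ 2 = 1 - tanh s ^ 2.
Proof.
unfold tanh; pose proof (cosh_pos s); pose proof (cosh_sinh_sq s).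
replace (1 - (sinh s / cosh s) ^ 2)
  with ((cosh s ^ 2 - sinh s ^ 2) * (/ cosh s) ^ 2) by (field; lra).
rewrite H0; ring.
Qed.

Lemma tanh_sq_lt1 s : tanh s ^ 2 < 1.
Proof.
pose proof (sech_tanh_sq s); pose proof (Rinv_0_lt_compat _ (cosh_pos s)); nra.
Qed.

Lemma tanh_bound s : -1 < tanh s < 1.
Proof. pose proof (tanh_sq_lt1 s); nra. Qed.

Lemma is_derive_tanh s : is_derive tanh s (1 - tanh s ^ 2).
Proof.
rewrite <- sech_tanh_sq.
assert (H : is_derive (fun x => sinh x / cosh x) s
  ((cosh s * cosh s - sinh s * sinh s) / cosh s ^ 2)).
{ apply is_derive_div.
  - apply is_derive_Reals, derivable_pt_lim_sinh.
  - apply is_derive_Reals, derivable_pt_lim_cosh.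
  - pose proof (cosh_pos s); lra. }
pose proof (cosh_sinh_sq s).
replace ((/ cosh s) ^ 2) with ((cosh s * cosh s - sinh s * sinh s) / cosh s ^ 2).
- exact H.
- replace (cosh s * cosh s - sinh s * sinh s) with 1 by lra.
  pose proof (cosh_pos s); field; lra.
Qed.

(* Squared sine of the angle whose tangent is [exp q]. *)
Definition sg (q : R) : R := exp (2 * q) / (1 + exp (2 * q)).

Lemma sg_bound q : 0 < sg q < 1.
Proof.
unfold sg; pose proof (exp_pos (2 * q)); split.
- apply Rdiv_lt_0_compat; lra.
- apply Rlt_div_l; lra.
Qed.

Lemma is_derive_sg q : is_derive sg q (2 * sg q * (1 - sg q)).
Proof.
unfold sg; pose proof (exp_pos (2 * q)).
auto_derive; [lra|]. field; lra.
Qed.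

Lemma mean_value (f f' : R -> R) a b :
  (forall t, Rmin a b <= t <= Rmax a b -> derivable_pt_lim f t (f' t)) ->
  exists c, Rmin a b <= c <= Rmax a b /\ f b - f a = f' c * (b - a).
Proof.
intros H; destruct (MVT_gen f a b f') as [c [Hc E]].
- intros x Hx; apply is_derive_Reals, H; lra.
- intros x Hx; apply derivable_continuous_pt; exists (f' x); now apply H.
- now exists c.
Qed.

Lemma lipschitz_of_derive (f f' : R -> R) C a b :
  (forall t, Rmin a b <= t <= Rmax a b -> derivable_pt_lim f t (f' t)) ->
  (forall t, Rmin a b <= t <= Rmax a b -> Rabs (f' t) <= C) ->
  Rabs (f b - f a) <= C * Rabs (b - a).
Proof.
intros H H'; destruct (mean_value f f' a b H) as [c [Hc ->]].
rewrite Rabs_mult; apply Rmult_le_compat_r; [apply Rabs_pos | now apply H'].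
Qed.

Lemma Rabs_tri x y a b : Rabs x <= a -> Rabs y <= b -> Rabs (x + y) <= a + b.
Proof. intros; eapply Rle_trans; [apply Rabs_triang | lra]. Qed.

Lemma Rabs_mul x y a b : Rabs x <= a -> Rabs y <= b -> Rabs (x * y) <= a * b.
Proof.
intros; rewrite Rabs_mult; apply Rmult_le_compat; auto using Rabs_pos.
Qed.

Lemma tanh_lipschitz s s' : Rabs (tanh s - tanh s') <= Rabs (s - s').
Proof.
rewrite <- (Rmult_1_l (Rabs (s - s'))).
apply lipschitz_of_derive with (f' := fun t => 1 - tanh t ^ 2).
- intros t _; apply is_derive_Reals, is_derive_tanh.
- intros t _; apply Rabs_le; pose proof (tanh_sq_lt1 t); nra.
Qed.

Lemma sg_lipschitz q q' : Rabs (sg q - sg q') <= Rabs (q - q').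
Proof.
rewrite <- (Rmult_1_l (Rabs (q - q'))).
apply lipschitz_of_derive with (f' := fun t => 2 * sg t * (1 - sg t)).
- intros t _; apply is_derive_Reals, is_derive_sg.
- intros t _; apply Rabs_le; pose proof (sg_bound t); nra.
Qed.

(* The reduced vector field in the coordinates [(s, q, phi)] with
   [y = tanh s] and [exp q = z / sqrt (1 - y^2 - z^2)]; here
   [A = V' / (sqrt 6 V)] and [B = (4 - 3 g) / (2 sqrt 6) * chi' / chi]. *)
Definition fs (g : R) (A B : R -> R) (s q p : R) : R :=
  - tanh s * (1 - g / 2 * sg q) - (1 - sg q) * A p + sg q * B p.
Definition fq (g : R) (A B : R -> R) (s q p : R) : R :=
  - (g / 2) - tanh s * (A p + B p).
Definition fp (s q p : R) : R := sqrt (2 / 3) * tanh s.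

(** * Bounds and Lipschitz constants of the reduced field *)

Definition lip_on (K M : R) (A : R -> R) : Prop :=
  (forall p, Rabs p <= M -> Rabs (A p) <= K) /\
  (forall p p', Rabs p <= M -> Rabs p' <= M ->
     Rabs (A p - A p') <= K * Rabs (p - p')).

Lemma sqrt23 : 0 < sqrt (2 / 3) < 1.
Proof.
split; [apply sqrt_lt_R0; lra|].
rewrite <- sqrt_1; apply sqrt_lt_1; lra.
Qed.

Section Field.
Variables (g : R) (A B : R -> R) (K M : R).
Hypotheses (hg : 0 < g < 2) (hK : 1 <= K) (hA : lip_on K M A) (hB : lip_on K M B).

Lemma fs_bound s q p : Rabs p <= M -> Rabs (fs g A B s q p) <= 2 * K.
Proof.
intros Hp; destruct hA as [HA _], hB as [HB _].
specialize (HA p Hp); specialize (HB p Hp).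
apply Rabs_le_between in HA; apply Rabs_le_between in HB.
pose proof (sg_bound q); pose proof (tanh_bound s); unfold fs.
assert (H1 : 0 < 1 - g / 2 * sg q < 1) by nra.
assert (H2 : Rabs (- tanh s * (1 - g / 2 * sg q)) <= 1 * 1)
  by (apply Rabs_mul; apply Rabs_le; lra).
apply Rabs_le_between in H2.
apply Rabs_le; nra.
Qed.

Lemma fq_bound s q p : Rabs p <= M -> Rabs (fq g A B s q p) <= 3 * K.
Proof.
intros Hp; destruct hA as [HA _], hB as [HB _].
specialize (HA p Hp); specialize (HB p Hp).
pose proof (tanh_bound s); unfold fq.
assert (H2 : Rabs (tanh s * (A p + B p)) <= 1 * (K + K))
  by (apply Rabs_mul; [apply Rabs_le; lra | now apply Rabs_tri]).
apply Rabs_le_between in H2; apply Rabs_le; lra.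
Qed.

Lemma fp_bound s q p : Rabs (fp s q p) <= 1.
Proof.
unfold fp; rewrite <- (Rmult_1_l 1); pose proof sqrt23; pose proof (tanh_bound s).
apply Rabs_mul; apply Rabs_le; lra.
Qed.

(** The dependence of [fs] on [s] is kept as an exact negative multiple of [s - s'], by the mean
    value theorem for [tanh], because this term is the only source of contraction. The other two
    variables are merely bounded. *)
Lemma fs_diff s q p s' q' p' : Rabs p <= M -> Rabs p' <= M ->
  exists m, Rmin s' s <= m <= Rmax s' s /\
  Rabs (fs g A B s q p - fs g A B s' q' p'
        + (1 - tanh m ^ 2) * (1 - g / 2 * sg q) * (s - s'))
    <= 3 * K * (Rabs (q - q') + Rabs (p - p')).
Proof.
intros Hp Hp'; destruct hA as [HA HA'], hB as [HB HB'].
specialize (HA p' Hp'); specialize (HB p' Hp').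
specialize (HA' p p' Hp Hp'); specialize (HB' p p' Hp Hp').
destruct (mean_value tanh (fun t => 1 - tanh t ^ 2) s' s) as [m [Hm E]].
{ intros t _; apply is_derive_Reals, is_derive_tanh. }
exists m; split; [easy|].
pose proof (sg_bound q); pose proof (sg_lipschitz q q') as HS.
pose proof (tanh_bound s').
replace (fs g A B s q p - fs g A B s' q' p' + _)
 with (((g / 2 * tanh s') + A p' + B p') * (sg q - sg q')
       + (- (1 - sg q) * (A p - A p') + sg q * (B p - B p'))).
2:{ unfold fs; rewrite (Rmult_comm (1 - tanh m ^ 2)), Rmult_assoc, <- E; ring. }
apply Rle_trans with ((1 + K + K) * Rabs (q - q')
   + ((1 - sg q) * (K * Rabs (p - p')) + sg q * (K * Rabs (p - p')))).
- apply Rabs_tri; [|apply Rabs_tri].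
  + apply Rabs_mul; [|easy].
    apply Rabs_tri; [|easy]; apply Rabs_tri; [|easy]; apply Rabs_le; nra.
  + apply Rabs_mul; [apply Rabs_le; lra | easy].
  + apply Rabs_mul; [apply Rabs_le; lra | easy].
- pose proof (Rabs_pos (q - q')); pose proof (Rabs_pos (p - p')); nra.
Qed.

Lemma fs_lip s q p s' q' p' : Rabs p <= M -> Rabs p' <= M ->
  Rabs (fs g A B s q p - fs g A B s' q' p')
    <= 3 * K * (Rabs (s - s') + Rabs (q - q') + Rabs (p - p')).
Proof.
intros Hp Hp'; destruct (fs_diff s q p s' q' p' Hp Hp') as [m [_ H]].
pose proof (tanh_sq_lt1 m); pose proof (sg_bound q).
assert (H2 : Rabs ((1 - tanh m ^ 2) * (1 - g / 2 * sg q) * (s - s'))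
   <= 1 * 1 * Rabs (s - s')).
{ apply Rabs_mul; [apply Rabs_mul | lra]; apply Rabs_le; nra. }
pose proof (Rabs_pos (s - s')).
apply Rabs_le_between in H; apply Rabs_le_between in H2; apply Rabs_le; nra.
Qed.

Lemma fq_lip s q p s' q' p' : Rabs p <= M -> Rabs p' <= M ->
  Rabs (fq g A B s q p - fq g A B s' q' p')
    <= 2 * K * (Rabs (s - s') + Rabs (p - p')).
Proof.
intros Hp Hp'; destruct hA as [HA HA'], hB as [HB HB'].
specialize (HA p Hp); specialize (HB p Hp).
specialize (HA' p p' Hp Hp'); specialize (HB' p p' Hp Hp').
pose proof (tanh_bound s'); pose proof (tanh_lipschitz s s').
replace (fq g A B s q p - fq g A B s' q' p')
 with ((- A p + - B p) * (tanh s - tanh s')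
       + - tanh s' * ((A p - A p') + (B p - B p'))) by (unfold fq; ring).
apply Rle_trans with ((K + K) * Rabs (s - s')
   + 1 * (K * Rabs (p - p') + K * Rabs (p - p'))); [|lra].
apply Rabs_tri; apply Rabs_mul; try easy.
- apply Rabs_tri; rewrite Rabs_Ropp; easy.
- apply Rabs_le; lra.
- now apply Rabs_tri.
Qed.

Lemma fp_lip s q p s' q' p' : Rabs (fp s q p - fp s' q' p') <= Rabs (s - s').
Proof.
unfold fp; rewrite <- Rmult_minus_distr_l, <- (Rmult_1_l (Rabs (s - s'))).
pose proof sqrt23; apply Rabs_mul; [apply Rabs_le; lra | apply tanh_lipschitz].
Qed.

Record traj := Traj { ts : R -> R; tq : R -> R; tp : R -> R }.

(* Orbits are parametrised backwards in time: [t] stands for [- tau]. *)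
Definition orbit (T : R) (u : traj) : Prop := forall t, 0 <= t <= T ->
  derivable_pt_lim (ts u) t (- fs g A B (ts u t) (tq u t) (tp u t)) /\
  derivable_pt_lim (tq u) t (- fq g A B (ts u t) (tq u t) (tp u t)) /\
  derivable_pt_lim (tp u) t (- fp (ts u t) (tq u t) (tp u t)) /\
  Rabs (tp u t) <= M.

(** * Two orbits compared over a short time interval *)

Section Orbits.
Variables (T t1 t2 : R).
Hypotheses (h1 : 0 <= t1) (h12 : t1 < t2) (h2 : t2 <= T).
Let h := t2 - t1.

Lemma increment_le (f f' : R -> R) C a b :
  (forall t, t1 <= t <= t2 -> derivable_pt_lim f t (f' t)) ->
  (forall t, t1 <= t <= t2 -> Rabs (f' t) <= C) ->
  t1 <= a <= t2 -> t1 <= b <= t2 -> Rabs (f b - f a) <= h * C.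
Proof.
intros H H' Ha Hb.
assert (Hr : forall t, Rmin a b <= t <= Rmax a b -> t1 <= t <= t2).
{ intros t; unfold Rmin, Rmax; destruct (Rle_dec a b); lra. }
assert (0 <= C) by (eapply Rle_trans; [apply Rabs_pos | apply (H' a Ha)]).
eapply Rle_trans; [apply lipschitz_of_derive with (f' := f') (C := C); auto|].
rewrite Rmult_comm; apply Rmult_le_compat_r; [easy|].
unfold h; apply Rabs_le; lra.
Qed.

Lemma orbit_increments u a b : orbit T u -> t1 <= a <= t2 -> t1 <= b <= t2 ->
  Rabs (ts u b - ts u a) <= h * (2 * K) /\
  Rabs (tq u b - tq u a) <= h * (3 * K) /\
  Rabs (tp u b - tp u a) <= h * 1.
Proof.
intros Hu Ha Hb.
assert (Hu' : forall t, t1 <= t <= t2 -> 0 <= t <= T) by (intros; lra).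
repeat split; (eapply increment_le; [| |exact Ha|exact Hb]);
  try (intros t Ht; apply (Hu t (Hu' t Ht)));
  intros t Ht; cbv beta; rewrite Rabs_Ropp;
  [apply fs_bound | apply fq_bound | apply fp_bound]; apply (Hu t (Hu' t Ht)).
Qed.

Variables (u v : traj).
Hypotheses (hu : orbit T u) (hv : orbit T v).
Let ds t := ts u t - ts v t.
Let dq t := tq u t - tq v t.
Let dp t := tp u t - tp v t.
Let Fs t := fs g A B (ts u t) (tq u t) (tp u t) - fs g A B (ts v t) (tq v t) (tp v t).
Let Fq t := fq g A B (ts u t) (tq u t) (tp u t) - fq g A B (ts v t) (tq v t) (tp v t).
Let Fp t := fp (ts u t) (tq u t) (tp u t) - fp (ts v t) (tq v t) (tp v t).

Lemma pair_derive t : t1 <= t <= t2 ->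
  derivable_pt_lim ds t (- Fs t) /\ derivable_pt_lim dq t (- Fq t) /\
  derivable_pt_lim dp t (- Fp t) /\ Rabs (tp u t) <= M /\ Rabs (tp v t) <= M.
Proof.
intros Ht; destruct (hu t) as (Su & Qu & Pu & Mu); [lra|].
destruct (hv t) as (Sv & Qv & Pv & Mv); [lra|].
repeat split; try easy; unfold Fs, Fq, Fp.
- replace (- _) with (- fs g A B (ts u t) (tq u t) (tp u t)
    - - fs g A B (ts v t) (tq v t) (tp v t)) by ring.
  now apply derivable_pt_lim_minus.
- replace (- _) with (- fq g A B (ts u t) (tq u t) (tp u t)
    - - fq g A B (ts v t) (tq v t) (tp v t)) by ring.
  now apply derivable_pt_lim_minus.
- replace (- _) with (- fp (ts u t) (tq u t) (tp u t)
    - - fp (ts v t) (tq v t) (tp v t)) by ring.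
  now apply derivable_pt_lim_minus.
Qed.

(* Gronwall over a short time, where each component of the difference is known
   to be small at its own instant. *)
Lemma pair_close e a b c : h * K <= / 18 ->
  t1 <= a <= t2 -> t1 <= b <= t2 -> t1 <= c <= t2 ->
  Rabs (ds a) <= e -> Rabs (dq b) <= e -> Rabs (dp c) <= e ->
  forall t, t1 <= t <= t2 ->
    Rabs (ds t - ds a) <= 18 * K * h * e /\
    Rabs (dq t - dq b) <= 18 * K * h * e /\
    Rabs (dp t - dp c) <= 18 * K * h * e.
Proof.
intros Hh Ha Hb Hc Ea Eb Ec.
set (N := fun t => Rabs (ds t) + Rabs (dq t) + Rabs (dp t)).
assert (CN : forall t, t1 <= t <= t2 -> continuity_pt N t).
{ intros t Ht; destruct (pair_derive t Ht) as (D1 & D2 & D3 & _).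
  assert (Ca : forall f f', derivable_pt_lim f t f' ->
    continuity_pt (fun x => Rabs (f x)) t).
  { intros f f' Hf; apply (continuity_pt_comp f Rabs).
    - apply derivable_continuous_pt; now exists f'.
    - apply Rcontinuity_abs. }
  unfold N; repeat apply continuity_pt_plus; eapply Ca; eassumption. }
destruct (continuity_ab_maj N t1 t2) as [tm [Hm Htm]]; [lra|easy|].
assert (Inc : forall t, t1 <= t <= t2 ->
    Rabs (ds t - ds a) <= h * (3 * K * N tm) /\
    Rabs (dq t - dq b) <= h * (3 * K * N tm) /\
    Rabs (dp t - dp c) <= h * (3 * K * N tm)).
{ intros t Ht; repeat split.
  - apply increment_le with (f' := fun t => - Fs t); auto.
    + intros; now apply pair_derive.
    + intros r Hr; rewrite Rabs_Ropp; destruct (pair_derive r Hr) as (_ & _ & _ & ? & ?).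
      eapply Rle_trans; [now apply fs_lip|].
      apply Rmult_le_compat_l; [lra | now apply Hm].
  - apply increment_le with (f' := fun t => - Fq t); auto.
    + intros; now apply pair_derive.
    + intros r Hr; rewrite Rabs_Ropp; destruct (pair_derive r Hr) as (_ & _ & _ & ? & ?).
      eapply Rle_trans; [now apply fq_lip|].
      specialize (Hm r Hr); unfold N at 1, ds, dq, dp in Hm.
      pose proof (Rabs_pos (ts u r - ts v r)); pose proof (Rabs_pos (tq u r - tq v r));
      pose proof (Rabs_pos (tp u r - tp v r)); nra.
  - apply increment_le with (f' := fun t => - Fp t); auto.
    + intros; now apply pair_derive.
    + intros r Hr; rewrite Rabs_Ropp.
      eapply Rle_trans; [apply fp_lip|].
      specialize (Hm r Hr); unfold N at 1, ds, dq, dp in Hm.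
      pose proof (Rabs_pos (ts u r - ts v r)); pose proof (Rabs_pos (tq u r - tq v r));
      pose proof (Rabs_pos (tp u r - tp v r)); nra. }
(* Each of the three increments is at most [N tm / 6] since [h * K <= / 18], so their sum gives
   [N tm <= 3 * e + N tm / 2]. *)
assert (HN : N tm <= 6 * e).
{ destruct (Inc tm Htm) as (I1 & I2 & I3).
  assert (0 <= N tm) by (unfold N; repeat apply Rplus_le_le_0_compat; apply Rabs_pos).
  assert (h * (3 * K * N tm) <= / 6 * N tm).
  { replace (h * (3 * K * N tm)) with (3 * (h * K) * N tm) by ring.
    apply Rmult_le_compat_r; lra. }
  assert (tri : forall x y, Rabs x <= Rabs (x - y) + Rabs y).
  { intros x y; pose proof (Rabs_triang (x - y) y) as Hxy.
    now replace (x - y + y) with x in Hxy by ring. }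
  pose proof (tri (ds tm) (ds a)); pose proof (tri (dq tm) (dq b));
  pose proof (tri (dp tm) (dp c)).
  assert (N tm = Rabs (ds tm) + Rabs (dq tm) + Rabs (dp tm)) by reflexivity.
  lra. }
assert (H3 : h * (3 * K * N tm) <= 18 * K * h * e).
{ replace (18 * K * h * e) with (3 * K * h * (6 * e)) by ring.
  replace (h * (3 * K * N tm)) with (3 * K * h * N tm) by ring.
  assert (0 <= h) by (unfold h; lra).
  apply Rmult_le_compat_l; [nra | easy]. }
intros t Ht; destruct (Inc t Ht) as (I1 & I2 & I3); repeat split; lra.
Qed.

Lemma pair_step f F : (forall t, t1 <= t <= t2 -> derivable_pt_lim f t (- F t)) ->
  exists t, t1 <= t <= t2 /\ f t1 = f t2 + h * F t.
Proof.
intros H; destruct (mean_value f (fun t => - F t) t1 t2) as [t [Ht E]].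
- intros t; rewrite Rmin_left, Rmax_right by lra; apply H.
- rewrite Rmin_left, Rmax_right in Ht by lra.
  exists t; split; [easy | unfold h; lra].
Qed.

(** The other two widths are only [h * eta], so the off-diagonal terms enter at relative order
    [h ^ 2]. The errors add up to [30 * K + 108 * K ^ 2]: [6 * K] from the variation of the rate,
    [18 * K] from that of [ds], the rest from [q] and [phi]; since [K <= K ^ 2], 138 bounds the
    sum. *)
Lemma ds_end c eta : 0 < eta <= h -> h * K <= / 18 ->
  c <= ts u t2 <= c + eta -> c <= ts v t2 <= c + eta ->
  Rabs (dq t2) <= h * eta -> Rabs (dp t2) <= h * eta ->
  ds t1 <= eta * (1 - h * ((1 - g / 2) * (1 - tanh c ^ 2)) + 138 * K ^ 2 * h ^ 2).
Proof.
intros Heta Hh Hu Hv Eq Ep.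
assert (h0 : 0 < h < 1) by (unfold h in *; nra).
assert (Hin : t1 <= t2 <= t2) by lra.
assert (Es : Rabs (ds t2) <= eta) by (unfold ds; apply Rabs_le; lra).
assert (h * eta <= eta) by nra.
destruct (pair_step ds Fs) as [t [Ht ->]]; [intros; now apply pair_derive|].
destruct (pair_close eta t2 t2 t2 Hh Hin Hin Hin Es ltac:(lra) ltac:(lra) t Ht)
  as (C1 & C2 & C3).
destruct (pair_derive t Ht) as (_ & _ & _ & Mu & Mv).
destruct (fs_diff (ts u t) (tq u t) (tp u t) (ts v t) (tq v t) (tp v t) Mu Mv)
  as [m [Hm HF]].
fold (Fs t) (ds t) (dq t) (dp t) in HF.
destruct (orbit_increments u t t2 hu Ht Hin) as (Iu & _ & _).
destruct (orbit_increments v t t2 hv Ht Hin) as (Iv & _ & _).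
set (w := (1 - tanh m ^ 2) * (1 - g / 2 * sg (tq u t))) in *.
set (d := 18 * K * h * eta) in *.
(* Motion between [t] and [t2] accounts for [2 * K * h], the width [eta <= h] of the interval for
   the rest. *)
assert (Hmc : Rabs (m - c) <= 3 * K * h).
{ apply Rabs_le_between in Iu; apply Rabs_le_between in Iv.
  assert (Rmin (ts v t) (ts u t) = ts v t \/ Rmin (ts v t) (ts u t) = ts u t)
    by (unfold Rmin; destruct Rle_dec; auto).
  assert (Rmax (ts v t) (ts u t) = ts v t \/ Rmax (ts v t) (ts u t) = ts u t)
    by (unfold Rmax; destruct Rle_dec; auto).
  apply Rabs_le; destruct H0 as [H0|H0], H1 as [H1|H1]; rewrite H0, H1 in Hm; nra. }
assert (Hw : (1 - g / 2) * (1 - tanh c ^ 2) - 6 * K * h <= w <= 1).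
{ pose proof (tanh_lipschitz m c) as L; pose proof (tanh_bound m);
  pose proof (tanh_bound c); pose proof (sg_bound (tq u t)).
  assert (L' : Rabs (tanh m - tanh c) <= 3 * K * h) by lra.
  apply Rabs_le_between in L'.
  assert (tanh m ^ 2 <= tanh c ^ 2 + 6 * K * h).
  { replace (tanh m ^ 2) with (tanh c ^ 2 + (tanh m - tanh c) * (tanh m + tanh c)) by ring.
    assert (Rabs ((tanh m - tanh c) * (tanh m + tanh c)) <= 3 * K * h * 2)
      by (apply Rabs_mul; apply Rabs_le; lra).
    apply Rabs_le_between in H3; lra. }
  pose proof (tanh_sq_lt1 m); pose proof (tanh_sq_lt1 c).
  assert (0 < 1 - g / 2 <= 1 - g / 2 * sg (tq u t)) by nra.
  assert (1 - g / 2 * sg (tq u t) <= 1) by nra.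
  assert (0 <= 6 * K * h) by nra.
  unfold w; split; [|nra].
  apply Rle_trans with ((1 - tanh m ^ 2) * (1 - g / 2)); [nra|].
  apply Rmult_le_compat_l; lra. }
assert (0 <= w).
{ unfold w; pose proof (tanh_sq_lt1 m); pose proof (sg_bound (tq u t)).
  apply Rmult_le_pos; nra. }
assert (Bq : Rabs (dq t) <= h * eta + d).
{ replace (dq t) with (dq t2 + (dq t - dq t2)) by ring; now apply Rabs_tri. }
assert (Bp : Rabs (dp t) <= h * eta + d).
{ replace (dp t) with (dp t2 + (dp t - dp t2)) by ring; now apply Rabs_tri. }
apply Rabs_le_between in C1.
assert (HF' : Fs t + w * ds t <= 3 * K * (2 * (h * eta + d))).
{ apply Rabs_le_between in HF. eapply Rle_trans; [apply HF|].
  apply Rmult_le_compat_l; lra. }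
assert (Hd : ds t2 - ds t <= d) by lra.
apply Rabs_le_between in Es.
(* The damping acts on [ds t]. Moving it to [ds t2], at the cost of a term at most [h * d], exposes
   the factor [1 - h * w >= 0], by which the bound [ds t2 <= eta] can be multiplied. *)
apply Rle_trans with (ds t2 * (1 - h * w) + h * (w * (ds t2 - ds t))
   + h * (3 * K * (2 * (h * eta + d)))); [nra|].
assert (0 <= d) by (unfold d; repeat apply Rmult_le_pos; lra).
assert (X1 : w * (ds t2 - ds t) <= d) by nra.
assert (X2 : ds t2 * (1 - h * w) <= eta * (1 - h * w)).
{ apply Rmult_le_compat_r; nra. }
assert (X3 : eta * (1 - h * w)
   <= eta * (1 - h * ((1 - g / 2) * (1 - tanh c ^ 2) - 6 * K * h))).
{ apply Rmult_le_compat_l; nra. }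
assert (X4 : h * (w * (ds t2 - ds t)) <= h * d) by (apply Rmult_le_compat_l; lra).
apply Rle_trans with (eta * (1 - h * ((1 - g / 2) * (1 - tanh c ^ 2) - 6 * K * h))
  + h * d + h * (3 * K * (2 * (h * eta + d)))); [lra|].
unfold d.
assert (0 <= eta * (h * h)) by nra.
assert (K <= K ^ 2) by nra.
replace (_ + h * (18 * K * h * eta) + _) with
 (eta * (1 - h * ((1 - g / 2) * (1 - tanh c ^ 2)))
   + (eta * (h * h)) * (30 * K + 108 * K ^ 2)) by ring.
replace (eta * (_ + 138 * K ^ 2 * h ^ 2)) with
 (eta * (1 - h * ((1 - g / 2) * (1 - tanh c ^ 2)))
   + (eta * (h * h)) * (138 * K ^ 2)) by ring.
apply Rplus_le_compat_l, Rmult_le_compat_l; lra.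
Qed.

(** [fq] does not contain [q], so the width in [q] changes only through the other variables, which
    are thinner by a factor [h]. Differences in [s] are known at [t1] and those in [phi] at [t2],
    matching the order in which [one_step] replaces the coordinates. The constant is the one of
    [ds_end], for uniformity. *)
Lemma dq_end eta : 0 < eta -> h * K <= / 18 ->
  Rabs (dq t2) <= eta -> Rabs (ds t1) <= h * eta -> Rabs (dp t2) <= h * eta ->
  dq t1 <= eta * (1 + 138 * K ^ 2 * h ^ 2).
Proof.
intros Heta Hh Eq Es Ep.
assert (h0 : 0 < h < 1) by (unfold h in *; nra).
assert (h * eta <= eta) by nra.
destruct (pair_step dq Fq) as [t [Ht ->]]; [intros; now apply pair_derive|].
destruct (pair_close eta t1 t2 t2 Hh ltac:(lra) ltac:(lra) ltac:(lra)
  ltac:(lra) ltac:(lra) ltac:(lra) t Ht) as (C1 & C2 & C3).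
destruct (pair_derive t Ht) as (_ & _ & _ & Mu & Mv).
pose proof (fq_lip (ts u t) (tq u t) (tp u t) (ts v t) (tq v t) (tp v t) Mu Mv) as HF.
fold (Fq t) (ds t) (dp t) in HF.
set (d := 18 * K * h * eta) in *.
assert (Bs : Rabs (ds t) <= h * eta + d).
{ replace (ds t) with (ds t1 + (ds t - ds t1)) by ring; now apply Rabs_tri. }
assert (Bp : Rabs (dp t) <= h * eta + d).
{ replace (dp t) with (dp t2 + (dp t - dp t2)) by ring; now apply Rabs_tri. }
assert (HF' : Fq t <= 2 * K * (2 * (h * eta + d))).
{ apply Rabs_le_between in HF. eapply Rle_trans; [apply HF|].
  apply Rmult_le_compat_l; lra. }
assert (h * Fq t <= h * (2 * K * (2 * (h * eta + d)))) by (apply Rmult_le_compat_l; lra).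
apply Rabs_le_between in Eq; unfold d in *.
assert (0 <= eta * (h * h)) by nra.
assert (K <= K ^ 2) by nra.
assert (h * (2 * K * (2 * (h * eta + 18 * K * h * eta)))
  <= eta * (h * h) * (138 * K ^ 2)); [|nra].
replace (h * _) with (eta * (h * h) * (4 * K + 72 * K ^ 2)) by ring.
apply Rmult_le_compat_l; lra.
Qed.

Lemma dp_end eta : 0 < eta -> h * K <= / 18 ->
  Rabs (dp t2) <= eta -> Rabs (ds t1) <= h * eta -> Rabs (dq t1) <= h * eta ->
  dp t1 <= eta * (1 + 138 * K ^ 2 * h ^ 2).
Proof.
intros Heta Hh Ep Es Eq.
assert (h0 : 0 < h < 1) by (unfold h in *; nra).
assert (h * eta <= eta) by nra.
destruct (pair_step dp Fp) as [t [Ht ->]]; [intros; now apply pair_derive|].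
destruct (pair_close eta t1 t1 t2 Hh ltac:(lra) ltac:(lra) ltac:(lra)
  ltac:(lra) ltac:(lra) ltac:(lra) t Ht) as (C1 & C2 & C3).
pose proof (fp_lip (ts u t) (tq u t) (tp u t) (ts v t) (tq v t) (tp v t)) as HF.
fold (Fp t) (ds t) in HF.
set (d := 18 * K * h * eta) in *.
assert (Bs : Rabs (ds t) <= h * eta + d).
{ replace (ds t) with (ds t1 + (ds t - ds t1)) by ring; now apply Rabs_tri. }
assert (HF' : Fp t <= h * eta + d) by (apply Rabs_le_between in HF; lra).
assert (h * Fp t <= h * (h * eta + d)) by (apply Rmult_le_compat_l; lra).
apply Rabs_le_between in Ep; unfold d in *.
assert (0 <= eta * (h * h)) by nra.
assert (K <= K ^ 2) by nra.
assert (h * (h * eta + 18 * K * h * eta) <= eta * (h * h) * (138 * K ^ 2)); [|nra].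
replace (h * _) with (eta * (h * h) * (1 + 18 * K)) by ring.
apply Rmult_le_compat_l; nra.
Qed.

End Orbits.
End Field.

(** * Contraction of weighted volume *)

(** Each cube is cut into [n * n] columns of [m] smaller cubes. The replaced coordinate moves to the
    last place and the next one to replace comes first, so three passes restore the order [s], [q],
    [phi]. *)
Lemma column_refine {U} (P : U -> Prop) (a b c a1 : U -> R) (e : R)
  (n m : nat) l : (0 < n)%nat -> (0 < m)%nat ->
  covers P a b c (INR n * e) l ->
  (forall u v, P u -> P v -> Rabs (a u - a v) <= INR n * e ->
     Rabs (b u - b v) <= e -> Rabs (c u - c v) <= e ->
     a1 u - a1 v <= INR m * e) ->
  exists l', covers P b c a1 e l' /\
    wsum (fun _ => 1) l' <= INR m * (INR n * INR n) * wsum (fun _ => 1) l.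
Proof.
intros Hn Hm C Hosc.
destruct (cover_union P (fun k u => in_cube (INR n * e) k (a u) (b u) (c u))
  b c a1 e (fun _ => 1) (fun _ => 1) (INR m * (INR n * INR n)) l) as [l' [C' S']].
- intros [[x y] z] _.
  rewrite Rmult_1_r.
  apply column_cover with (y := y) (z := z); auto.
  + intros u [_ [_ [? ?]]]; now split.
  + intros u v [Pu [Hu _]] [Pv [Hv _]]; apply Hosc; auto; apply Rabs_le; lra.
- exists l'; split; [|easy].
  refine (covers_weaken _ _ _ _ _ _ _ _ C').
  intros u Pu; split; [easy|]; destruct (C u Pu) as [k [? ?]]; now exists k.
Qed.

Lemma nat_above x : 0 <= x ->
  exists m, (0 < m)%nat /\ x <= INR m <= x + 1.
Proof.
intros Hx; destruct (nfloor_ex x Hx) as [n Hn]; exists (S n).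
rewrite S_INR; split; [lia | lra].
Qed.

Lemma in_cube_close e k a b c a' b' c' :
  in_cube e k a b c -> in_cube e k a' b' c' ->
  Rabs (a - a') <= e /\ Rabs (b - b') <= e /\ Rabs (c - c') <= e.
Proof.
destruct k as [[x y] z]; intros (? & ? & ?) (? & ? & ?).
repeat split; apply Rabs_le; lra.
Qed.

(* The weight making the contraction of volume uniform: [tanh s * phi] grows
   at a definite rate where [tanh s ^ 2] is close to 1, that is where the
   divergence of the reduced field degenerates. *)
Definition wt (d : R) (k : cube) : R :=
  let '(s, _, p) := k in exp (- d * (tanh s * p)).

Lemma wt_pos d k : 0 < wt d k.
Proof. destruct k as [[s q] p]; apply exp_pos. Qed.

Lemma tanh_mul_close M e s p s' p' : Rabs p <= M ->
  Rabs (s - s') <= e -> Rabs (p - p') <= e ->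
  Rabs (tanh s * p - tanh s' * p') <= e * (M + 1).
Proof.
intros Hp Hs Hp'.
replace (tanh s * p - tanh s' * p')
  with ((tanh s - tanh s') * p + tanh s' * (p - p')) by ring.
replace (e * (M + 1)) with (e * M + 1 * e) by ring.
apply Rabs_tri; apply Rabs_mul; auto.
- eapply Rle_trans; [apply tanh_lipschitz | easy].
- pose proof (tanh_bound s'); apply Rabs_le; lra.
Qed.

Lemma exp_mono x y : x <= y -> exp x <= exp y.
Proof.
intros [H| ->]; [left; now apply exp_increasing | apply Rle_refl].
Qed.

Section Step.
Variables (g : R) (A B : R -> R) (K M : R).
Hypotheses (hg : 0 < g < 2) (hK : 1 <= K) (hM : 1 <= M)
  (hA : lip_on K M A) (hB : lip_on K M B).

(** With [y = tanh s], the volume contracts at rate at least [k0 * (1 - y ^ 2)]. The choice of [d]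
    gives [d * (2 * K * M) = k0 / 2], so a drift of the weight in the wrong direction uses up at
    most half of it; [c0] is the uniform rate that results. In [D], 417 is three times the 138 of
    the width estimates plus 3 for rounding up three cube counts; the other term comes from
    [weight_decay]. *)
Let k0 := 1 - g / 2.
Let d := k0 / (4 * K * M).
Let c0 := d * sqrt (2 / 3).
Let D := 417 * K ^ 2 + d * (6 * K * (1 + 2 * K * M) + 2 * (M + 1)).

Lemma delta_pos : 0 < d.
Proof. unfold d, k0; apply Rdiv_lt_0_compat; nra. Qed.

Section Interval.
Variables (T t1 t2 : R).
Hypotheses (h1 : 0 <= t1) (h12 : t1 < t2) (h2 : t2 <= T).
Let h := t2 - t1.
Hypothesis hh : h * K <= / 18.

(** Forward in time [y * phi], with [y = tanh s], has derivative [(1 - y ^ 2) * fs * phi + sqrt (2 /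
    3) * y ^ 2], whose first term is at least [- 2 * K * M * (1 - y ^ 2)]. Freezing [y ^ 2] at the
    corner of the cube costs [6 * K * h * (1 + 2 * K * M)] in this rate. Passing between the
    trajectory and the two corners costs [(eta + eta') * (M + 1)], of second order because both
    sides are at most [h ^ 2]. *)
Lemma weight_decay u eta eta' s q p k' : orbit g A B M T u ->
  0 < eta <= h ^ 2 -> 0 < eta' <= h ^ 2 ->
  in_cube eta (s, q, p) (ts u t2) (tq u t2) (tp u t2) ->
  in_cube eta' k' (ts u t1) (tq u t1) (tp u t1) ->
  wt d k' <= wt d (s, q, p) *
    exp (d * (- h * (sqrt (2 / 3) * tanh s ^ 2 - 2 * K * M * (1 - tanh s ^ 2))
         + h ^ 2 * (6 * K * (1 + 2 * K * M) + 2 * (M + 1)))).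
Proof.
intros Hu Heta Heta' (Hs & Hq & Hp) H'.
destruct k' as [[s' q'] p'], H' as (Hs' & Hq' & Hp').
simpl; rewrite <- exp_plus.
apply exp_mono.
assert (h0 : 0 < h < 1) by (unfold h in *; nra).
destruct (mean_value (fun t => tanh (ts u t) * tp u t)
  (fun t => - ((1 - tanh (ts u t) ^ 2) * fs g A B (ts u t) (tq u t) (tp u t)
     * tp u t + sqrt (2 / 3) * tanh (ts u t) ^ 2)) t1 t2) as [t [Ht E]].
{ intros t; rewrite Rmin_left, Rmax_right by lra; intros Ht.
  destruct (Hu t) as (Ds & _ & Dp & _); [lra|].
  replace (- _) with ((1 - tanh (ts u t) ^ 2) * - fs g A B (ts u t) (tq u t) (tp u t)
    * tp u t + tanh (ts u t) * - fp (ts u t) (tq u t) (tp u t))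
    by (unfold fp; ring).
  apply (derivable_pt_lim_mult (fun t => tanh (ts u t)) (tp u)); [|easy].
  apply (derivable_pt_lim_comp (ts u) tanh); [easy|].
  apply is_derive_Reals, is_derive_tanh. }
rewrite Rmin_left, Rmax_right in Ht by lra.
fold h in E.
destruct (Hu t) as (_ & _ & _ & Mt); [lra|].
destruct (Hu t1) as (_ & _ & _ & M1); [lra|].
destruct (Hu t2) as (_ & _ & _ & M2); [lra|].
pose proof (fs_bound g A B K M hg hK hA hB (ts u t) (tq u t) (tp u t) Mt) as Bf.
destruct (orbit_increments g A B K M hg hK hA hB T t1 t2 h1 h2 u t2 t Hu)
  as (Is & _ & _); [lra|lra|fold h in Is].
set (y := tanh s) in *.
assert (Hy : Rabs (tanh (ts u t) - y) <= 3 * K * h).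
{ eapply Rle_trans; [apply tanh_lipschitz|].
  apply Rabs_le_between in Is; apply Rabs_le; nra. }
assert (Hy2 : Rabs (tanh (ts u t) ^ 2 - y ^ 2) <= 6 * K * h).
{ replace (tanh (ts u t) ^ 2 - y ^ 2)
    with ((tanh (ts u t) - y) * (tanh (ts u t) + y)) by ring.
  replace (6 * K * h) with (3 * K * h * 2) by ring.
  pose proof (tanh_bound (ts u t)); pose proof (tanh_bound s); fold y in H0.
  apply Rabs_mul; [easy | apply Rabs_le; lra]. }
set (Y2 := tanh (ts u t) ^ 2) in *.
set (f := fs _ _ _ _ _ _) in *.
assert (HY : 0 <= Y2 < 1) by (split; [apply pow2_ge_0 | apply tanh_sq_lt1]).
assert (HG : - ((1 - Y2) * (2 * K * M)) <= (1 - Y2) * f * tp u t).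
{ assert (G : Rabs (f * tp u t) <= 2 * K * M) by now apply Rabs_mul.
  apply Rabs_le_between in G; nra. }
pose proof (tanh_mul_close M eta (ts u t2) (tp u t2) s p M2) as W2.
pose proof (tanh_mul_close M eta' (ts u t1) (tp u t1) s' p' M1) as W1.
assert (E2 := W2 ltac:(apply Rabs_le; lra) ltac:(apply Rabs_le; lra)).
assert (E1 := W1 ltac:(apply Rabs_le; lra) ltac:(apply Rabs_le; lra)).
fold y in E2; clear W1 W2.
apply Rabs_le_between in E1; apply Rabs_le_between in E2; apply Rabs_le_between in Hy2.
pose proof delta_pos; pose proof sqrt23.
set (G := 2 * K * M) in *.
assert (0 < G) by (unfold G; nra).
assert (LG : sqrt (2 / 3) * y ^ 2 - G * (1 - y ^ 2) - 6 * K * h * (1 + G)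
   <= (1 - Y2) * f * tp u t + sqrt (2 / 3) * Y2).
{ assert (sqrt (2 / 3) * (y ^ 2 - Y2) <= 1 * (6 * K * h)).
  { destruct (Rle_dec 0 (y ^ 2 - Y2)); nra. }
  assert (G * (y ^ 2 - Y2) <= G * (6 * K * h)) by (apply Rmult_le_compat_l; lra).
  lra. }
assert (eta * (M + 1) <= h ^ 2 * (M + 1)) by (apply Rmult_le_compat_r; lra).
assert (eta' * (M + 1) <= h ^ 2 * (M + 1)) by (apply Rmult_le_compat_r; lra).
assert (h * (sqrt (2 / 3) * y ^ 2 - G * (1 - y ^ 2) - 6 * K * h * (1 + G))
   <= h * ((1 - Y2) * f * tp u t + sqrt (2 / 3) * Y2))
  by (apply Rmult_le_compat_l; lra).
set (x' := tanh s' * p') in *; set (x := y * p) in *.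
replace (- d * x + _) with (d * (- x + (- h * (sqrt (2 / 3) * y ^ 2 - G * (1 - y ^ 2)) +
    h ^ 2 * (6 * K * (1 + G) + 2 * (M + 1))))) by ring.
replace (- d * x') with (d * (- x')) by ring.
apply Rmult_le_compat_l; [lra|].
nra.
Qed.

(** Three passes, over [s], [q] and [phi], each dividing the side by [n] so that the next columns
    are thin enough. A cube of side [eta] contains [INR n ^ 9] cubes of side [eta / INR n ^ 3], so
    the exponential is the ratio of weighted volumes. The bound on [n] serves twice: it makes the
    columns thin, and rounding up a count is a relative error of at most [h ^ 2]. *)
Lemma one_step (P : traj -> Prop) eta n (k : cube) :
  (forall u, P u -> orbit g A B M T u) -> 0 < eta <= h ^ 2 -> 1 <= INR n * h ^ 2 ->
  exists l, covers (fun u => P u /\ in_cube eta k (ts u t2) (tq u t2) (tp u t2))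
     (fun u => ts u t1) (fun u => tq u t1) (fun u => tp u t1) (eta / INR n ^ 3) l /\
   wsum (wt d) l <= exp (- c0 * h + D * h ^ 2) * INR n ^ 9 * wt d k.
Proof.
intros HP Heta Hn.
assert (h0 : 0 < h < 1) by (unfold h in *; nra).
assert (Hh2 : h ^ 2 < h) by nra.
assert (n0 : (0 < n)%nat) by (destruct n; [simpl in Hn; lra | lia]).
assert (nr : 1 <= INR n) by (apply (le_INR 1); lia).
assert (Hinv : / INR n <= h ^ 2).
{ apply Rmult_le_reg_l with (INR n); [lra|]; rewrite Rinv_r; lra. }
destruct k as [[s q] p].
set (Q := fun u => P u /\ _).
set (y2 := tanh s ^ 2).
set (L1 := 1 - h * (k0 * (1 - y2)) + 138 * K ^ 2 * h ^ 2).
set (L2 := 1 + 138 * K ^ 2 * h ^ 2).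
assert (Hy2 : 0 <= y2 < 1) by (split; [apply pow2_ge_0 | apply tanh_sq_lt1]).
assert (0 <= L1).
{ unfold L1; assert (0 <= k0 <= 1) by (unfold k0; lra).
  assert (k0 * (1 - y2) <= 1) by nra.
  pose proof (pow2_ge_0 (K * h)); nra. }
assert (0 <= L2) by (unfold L2; pose proof (pow2_ge_0 (K * h)); nra).
destruct (nat_above (INR n * L1)) as [m1 [m10 Hm1]]; [apply Rmult_le_pos; lra|].
destruct (nat_above (INR n * L2)) as [m2 [m20 Hm2]]; [apply Rmult_le_pos; lra|].
set (e1 := eta / INR n); set (e2 := e1 / INR n); set (e3 := e2 / INR n).
assert (E1 : INR n * e1 = eta) by (unfold e1; field; lra).
assert (E2 : INR n * e2 = e1) by (unfold e2; field; lra).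
assert (E3 : INR n * e3 = e2) by (unfold e3; field; lra).
assert (H1 : 0 < e1) by (apply Rdiv_lt_0_compat; lra).
assert (H2 : 0 < e2) by (apply Rdiv_lt_0_compat; lra).
assert (H3 : 0 < e3) by (apply Rdiv_lt_0_compat; lra).
assert (S1 : e1 <= h * eta) by (unfold e1, Rdiv; rewrite Rmult_comm; apply Rmult_le_compat_r; lra).
assert (S2 : e2 <= h * e1) by (unfold e2, Rdiv; rewrite Rmult_comm; apply Rmult_le_compat_r; lra).
assert (S3 : e3 <= h * e2) by (unfold e3, Rdiv; rewrite Rmult_comm; apply Rmult_le_compat_r; lra).
destruct (column_cover Q (fun u => ts u t1) (fun u => tq u t2) (fun u => tp u t2)
  q p e1 n m1 n0 m10) as [l1 [C1 N1]].
{ intros u [_ (_ & ? & ?)]; rewrite E1; now split. }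
{ intros u v [Pu (Su & _ & _)] [Pv (Sv & _ & _)] Hq Hp.
  apply Rle_trans with (eta * L1).
  - refine (ds_end g A B K M hg hK hA hB T t1 t2 h1 h12 h2 u v (HP _ Pu) (HP _ Pv)
      s eta _ hh Su Sv _ _); fold h; lra.
  - rewrite <- E1.
    replace (INR n * e1 * L1) with (INR n * L1 * e1) by ring.
    apply Rmult_le_compat_r; lra. }
rewrite <- E2 in C1.
destruct (column_refine Q _ _ _ (fun u => tq u t1) e2 n m2 l1 n0 m20 C1) as [l2 [C2 N2]].
{ intros u v [Pu _] [Pv _] Hq Hp Hs; rewrite E2 in Hq.
  apply Rle_trans with (e1 * L2).
  - refine (dq_end g A B K M hg hK hA hB T t1 t2 h1 h12 h2 u v (HP _ Pu) (HP _ Pv)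
      e1 H1 hh Hq _ _); fold h; lra.
  - rewrite <- E2.
    replace (INR n * e2 * L2) with (INR n * L2 * e2) by ring.
    apply Rmult_le_compat_r; lra. }
rewrite <- E3 in C2.
destruct (column_refine Q _ _ _ (fun u => tp u t1) e3 n m2 l2 n0 m20 C2) as [l3 [C3 N3]].
{ intros u v [Pu _] [Pv _] Hp Hs Hq; rewrite E3 in Hp.
  apply Rle_trans with (e2 * L2).
  - refine (dp_end g A B K M hg hK hA hB T t1 t2 h1 h12 h2 u v (HP _ Pu) (HP _ Pv)
      e2 H2 hh Hp _ _); fold h; lra.
  - rewrite <- E3.
    replace (INR n * e3 * L2) with (INR n * L2 * e3) by ring.
    apply Rmult_le_compat_r; lra. }
(* After pruning, every cube is visited by a trajectory that also meets the initial cube, which is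
   what [weight_decay] asks for. *)
destruct (cover_prune Q (fun u => ts u t1) (fun u => tq u t1) (fun u => tp u t1)
  e3 (fun _ => 1) l3) as [l [C [N Ne]]]; [intros; lra | easy |].
exists l; split.
{ replace (eta / INR n ^ 3) with e3 by (unfold e3, e2, e1; field; lra); exact C. }
set (X := exp (d * (- h * (sqrt (2 / 3) * y2 - 2 * K * M * (1 - y2))
         + h ^ 2 * (6 * K * (1 + 2 * K * M) + 2 * (M + 1))))).
apply Rle_trans with (wsum (fun _ => wt d (s, q, p) * X) l).
{ apply wsum_le; intros k' Hk'; destruct (Ne k' Hk') as [u [[Pu Hu] Hu']].
  apply weight_decay with (1 := HP u Pu) (4 := Hu) (5 := Hu'); [easy|].
  assert (h * eta <= eta) by nra; assert (h * e1 <= e1) by nra;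
  assert (h * e2 <= e2) by nra; lra. }
assert (X0 : 0 < X) by apply exp_pos; pose proof (wt_pos d (s, q, p)) as W0.
rewrite wsum_const.
assert (Hcount : INR (length l) <= INR m1 * INR m2 * INR m2 * INR n ^ 6).
{ pose proof (pos_INR m2).
  rewrite (wsum_const 1 l) in N.
  set (a1 := wsum _ l1) in *; set (a2 := wsum _ l2) in *; set (a3 := wsum _ l3) in *.
  set (r := INR m2 * (INR n * INR n)) in *.
  assert (0 <= r) by (unfold r; apply Rmult_le_pos; nra).
  assert (r * a2 <= r * (r * a1)) by now apply Rmult_le_compat_l.
  assert (r * (r * a1) <= r * (r * (INR m1 * (INR n * INR n))))
    by (repeat apply Rmult_le_compat_l; auto).
  replace (INR m1 * INR m2 * INR m2 * INR n ^ 6)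
    with (r * (r * (INR m1 * (INR n * INR n)))) by (unfold r; ring).
  lra. }
(* Here [INR n * x + 1 <= INR n * (x + h ^ 2)], and [1 + v <= exp v] turns the counts into
   exponentials whose exponents can be added. *)
assert (Hexp : forall x, 0 <= x -> forall m, INR m <= INR n * x + 1 ->
   INR m <= INR n * exp (x - 1 + h ^ 2)).
{ intros x Hx m Hm.
  assert (1 + (x - 1 + h ^ 2) <= exp (x - 1 + h ^ 2)) by apply exp_ineq1_le.
  nra. }
assert (Z1 := Hexp L1 ltac:(easy) m1 ltac:(lra)).
assert (Z2 := Hexp L2 ltac:(easy) m2 ltac:(lra)).
set (Y1 := exp (L1 - 1 + h ^ 2)) in *; set (Y2 := exp (L2 - 1 + h ^ 2)) in *.
assert (0 < Y1) by apply exp_pos; assert (0 < Y2) by apply exp_pos.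
assert (Hm : INR m1 * INR m2 * INR m2 <= (INR n * Y1) * (INR n * Y2) * (INR n * Y2)).
{ pose proof (pos_INR m1); pose proof (pos_INR m2).
  repeat apply Rmult_le_compat; auto; apply Rmult_le_pos; auto. }
assert (Hfin : Y1 * Y2 * Y2 * X <= exp (- c0 * h + D * h ^ 2)).
{ unfold Y1, Y2, X; rewrite <- !exp_plus; apply exp_mono.
  unfold L1, L2, D, c0.
  pose proof delta_pos; pose proof sqrt23.
  assert (Hd : d * (2 * K * M) = k0 / 2) by (unfold d; field; lra).
  assert (Hd2 : d <= k0 / 4).
  { apply Rmult_le_reg_r with (2 * K * M); [nra|]; rewrite Hd.
    assert (2 <= 2 * K * M) by nra; assert (0 < k0) by (unfold k0; lra); nra. }
  assert (HK2 : 3 * h ^ 2 <= 3 * K ^ 2 * h ^ 2).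
  { assert (1 <= K ^ 2) by nra; assert (0 <= h ^ 2) by (apply pow2_ge_0); nra. }
  (* Contraction and weight together have rate at least [c0] for every [y2]: half of the contraction
     remains, and [k0 / 2 * (1 - y2)] exceeds the missing [d * sqrt (2 / 3) * (1 - y2)] because
     [d <= k0 / 4]. *)
  assert (key : d * sqrt (2 / 3) <= k0 * (1 - y2) + d * (sqrt (2 / 3) * y2)
     - d * (2 * K * M) * (1 - y2)).
  { rewrite Hd; assert (d * sqrt (2 / 3) * (1 - y2) <= k0 / 2 * (1 - y2)); [|lra].
    apply Rmult_le_compat_r; nra. }
  apply (Rmult_le_compat_l h) in key; [|lra].
  set (Z := 6 * K * (1 + 2 * K * M) + 2 * (M + 1)).
  set (W := d * (2 * K * M)) in *.
  replace (d * (- h * _ + h ^ 2 * Z)) with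
   (- h * (d * (sqrt (2 / 3) * y2) - W * (1 - y2)) + d * Z * h ^ 2)
   by (unfold W; ring).
  nra. }
apply Rle_trans with ((INR n * Y1) * (INR n * Y2) * (INR n * Y2) * INR n ^ 6
   * (wt d (s, q, p) * X)).
{ apply Rmult_le_compat_r; [nra|].
  eapply Rle_trans; [apply Hcount|].
  apply Rmult_le_compat_r; [apply pow_le; lra | easy]. }
replace (_ * INR n ^ 6 * _) with ((Y1 * Y2 * Y2 * X) * (INR n ^ 9 * wt d (s, q, p))) by ring.
rewrite (Rmult_assoc (exp _)).
apply Rmult_le_compat_r; [|easy].
apply Rmult_le_pos; [apply pow_le; lra | lra].
Qed.

End Interval.
End Step.

(** Zero Jordan content: the covers are finite and their cubes are equal, as the contraction
    argument produces them. *)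
Definition fnull (E : R -> R -> R -> Prop) : Prop :=
  forall eps, 0 < eps -> exists e l, 0 < e /\ INR (length l) * e ^ 3 < eps /\
    forall x y z, E x y z -> exists k, In k l /\ in_cube e k x y z.

Lemma box_cover {U} (P : U -> Prop) (a b c : U -> R) H e : 0 <= H -> 0 < e ->
  (forall u, P u -> Rabs (a u) <= H /\ Rabs (b u) <= H /\ Rabs (c u) <= H) ->
  exists l, covers P a b c e l /\ INR (length l) * e ^ 3 <= (2 * H + e) ^ 3.
Proof.
intros H0 He HP.
destruct (nat_above (2 * H / e)) as [n [n0 Hn]].
{ apply Rdiv_le_0_compat; lra. }
assert (Hne : 2 * H <= INR n * e <= 2 * H + e).
{ replace (2 * H) with (2 * H / e * e) by (field; lra); split; nra. }
exists (map (fun ijk : nat * nat * nat => let '(i, j, k) := ijk in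
   (- H + INR i * e, - H + INR j * e, - H + INR k * e))
   (list_prod (list_prod (seq 0 n) (seq 0 n)) (seq 0 n))).
split.
- intros u Pu; destruct (HP u Pu) as (Ha & Hb & Hc).
  apply Rabs_le_between in Ha; apply Rabs_le_between in Hb; apply Rabs_le_between in Hc.
  destruct (grid_index (a u) (- H) e n n0) as [i [Hi Hi']]; [lra|].
  destruct (grid_index (b u) (- H) e n n0) as [j [Hj Hj']]; [lra|].
  destruct (grid_index (c u) (- H) e n n0) as [k [Hk Hk']]; [lra|].
  exists (- H + INR i * e, - H + INR j * e, - H + INR k * e); split.
  + apply in_map_iff; exists (i, j, k); split; [easy|].
    apply in_prod; [apply in_prod|]; apply in_seq; lia.
  + now repeat split.
- rewrite length_map, !length_prod, !length_seq, !mult_INR.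
  replace (INR n * INR n * INR n * e ^ 3) with ((INR n * e) ^ 3) by ring.
  apply pow_incr; split; [apply Rmult_le_pos; [apply pos_INR | lra] | lra].
Qed.

Lemma exp_pow x n : exp x ^ n = exp (INR n * x).
Proof.
induction n as [|n IH]; [simpl; rewrite Rmult_0_l, exp_0; easy|].
rewrite S_INR; simpl pow; rewrite IH, <- exp_plus; f_equal; ring.
Qed.

(** [exp (- kap) ^ j] is the fourth power of [x = exp (- (kap * INR j / 4))]. Three factors absorb
    the cubic, since [x * w <= 1] and the linear term is at most [B * w]; the fourth factor, at most
    [/ w], tends to 0. *)
Lemma exp_beats_cubic kap a b C eps : 0 < kap -> 0 <= a -> 0 <= b -> 0 <= C ->
  0 < eps -> exists j, (0 < j)%nat /\
    C * exp (- kap) ^ j * (a + b * INR j) ^ 3 < eps.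
Proof.
intros Hk Ha Hb HC He.
set (B := a + 4 * b / kap).
assert (HB : 0 <= B).
{ unfold B; apply Rplus_le_le_0_compat; [easy|]; apply Rdiv_le_0_compat; lra. }
destruct (nat_above (4 * (C * B ^ 3) / (kap * eps))) as [j [j0 Hj]].
{ apply Rdiv_le_0_compat; [|nra].
  apply Rmult_le_pos; [lra|]; apply Rmult_le_pos; [easy | now apply pow_le]. }
exists j; split; [easy|].
assert (jp : 0 < INR j) by now apply (lt_INR 0).
set (w := 1 + kap * INR j / 4).
assert (Hw : 1 < w) by (unfold w; nra).
set (x := exp (- (kap * INR j / 4))).
assert (Hx : 0 < x) by apply exp_pos.
assert (Hxw : x * w <= 1).
{ unfold x; rewrite exp_Ropp.
  pose proof (exp_ineq1_le (kap * INR j / 4)); fold w in H.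
  apply Rmult_le_reg_l with (exp (kap * INR j / 4)); [apply exp_pos|].
  pose proof (exp_pos (kap * INR j / 4)).
  rewrite <- Rmult_assoc, Rinv_r; lra. }
assert (E : exp (- kap) ^ j = x ^ 4).
{ unfold x; rewrite !exp_pow; f_equal; simpl INR; field. }
rewrite E.
assert (HBw : 0 <= a + b * INR j <= B * w).
{ split; [nra|].
  replace (B * w) with (a + b * INR j + (4 * b / kap + a * (kap * INR j / 4)))
    by (unfold B, w; field; lra).
  assert (0 <= 4 * b / kap) by (apply Rdiv_le_0_compat; lra).
  assert (0 <= a * (kap * INR j / 4)) by (apply Rmult_le_pos; nra).
  lra. }
assert (H3 : (a + b * INR j) ^ 3 <= (B * w) ^ 3) by now apply pow_incr.
assert (H4 : (x * w) ^ 3 <= 1) by (rewrite <- (pow1 3); apply pow_incr; nra).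
assert (CB : 0 <= C * B ^ 3) by (apply Rmult_le_pos; [easy | now apply pow_le]).
apply Rle_lt_trans with (C * B ^ 3 * x).
- apply Rle_trans with (C * x ^ 4 * (B * w) ^ 3).
  + apply Rmult_le_compat_l; [|easy].
    apply Rmult_le_pos; [easy|]; apply pow_le; lra.
  + replace (C * x ^ 4 * (B * w) ^ 3) with (C * B ^ 3 * x * (x * w) ^ 3) by ring.
    rewrite <- (Rmult_1_r (C * B ^ 3 * x)) at 2.
    apply Rmult_le_compat_l; [nra | easy].
- assert (HJ : 4 * (C * B ^ 3) <= INR j * (kap * eps)).
  { replace (4 * (C * B ^ 3)) with (4 * (C * B ^ 3) / (kap * eps) * (kap * eps))
      by (field; lra).
    apply Rmult_le_compat_r; nra. }
  assert (C * B ^ 3 < eps * w) by (unfold w; nra).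
  apply Rle_lt_trans with (C * B ^ 3 * / w).
  + apply Rmult_le_compat_l; [easy|].
    apply Rmult_le_reg_r with w; [lra|]; rewrite Rinv_l; lra.
  + apply Rmult_lt_reg_r with w; [lra|].
    rewrite Rmult_assoc, Rinv_l; lra.
Qed.

(** * Iterated contraction over long times *)

Section Contraction.
Variables (g : R) (A B : R -> R) (K M : R).
Hypotheses (hg : 0 < g < 2) (hK : 1 <= K) (hM : 1 <= M)
  (hA : lip_on K M A) (hB : lip_on K M B).

Let k0 := 1 - g / 2.
Let d := k0 / (4 * K * M).
Let c0 := d * sqrt (2 / 3).
Let D := 417 * K ^ 2 + d * (6 * K * (1 + 2 * K * M) + 2 * (M + 1)).

(** Iterates [one_step] from parameter [j * h] down to 0. In the product of weight and cube volume,
    the factor [INR n ^ 9] cancels against the cube of [eta / INR n ^ 3]. *)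
Lemma pull_back T h n (P : traj -> Prop) :
  0 < h -> h * K <= / 18 -> 1 <= INR n * h ^ 2 ->
  (forall u, P u -> orbit g A B M T u) ->
  forall j eta l, INR j * h <= T -> 0 < eta <= h ^ 2 ->
  covers P (fun u => ts u (INR j * h)) (fun u => tq u (INR j * h))
    (fun u => tp u (INR j * h)) eta l ->
  exists eta' l', 0 < eta' <= h ^ 2 /\
    covers P (fun u => ts u 0) (fun u => tq u 0) (fun u => tp u 0) eta' l' /\
    wsum (wt d) l' * eta' ^ 3 <=
      exp (- c0 * h + D * h ^ 2) ^ j * (wsum (wt d) l * eta ^ 3).
Proof.
intros h0 hh Hn HP j.
assert (n0 : 1 <= INR n).
{ destruct n as [|n]; [simpl in Hn; lra | apply (le_INR 1); lia]. }
assert (n1 : 0 < INR n ^ 3) by (apply pow_lt; lra).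
induction j as [|j IH]; intros eta l Hj Heta C.
- simpl INR in C; rewrite Rmult_0_l in C.
  exists eta, l; repeat split; try easy; simpl; lra.
- rewrite S_INR in Hj, C.
  destruct (cover_union P
    (fun k u => in_cube eta k (ts u ((INR j + 1) * h)) (tq u ((INR j + 1) * h))
       (tp u ((INR j + 1) * h)))
    (fun u => ts u (INR j * h)) (fun u => tq u (INR j * h))
    (fun u => tp u (INR j * h)) (eta / INR n ^ 3) (wt d) (wt d)
    (exp (- c0 * h + D * h ^ 2) * INR n ^ 9) l) as [l1 [C1 S1]].
  { intros k _.
    assert (Eh : (INR j + 1) * h - INR j * h = h) by ring.
    pose proof (pos_INR j).
    pose proof (one_step g A B K M hg hK hM hA hB T (INR j * h) ((INR j + 1) * h)
      ltac:(nra) ltac:(nra) Hj) as OS.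
    rewrite Eh in OS; apply (OS hh P eta n k HP Heta Hn). }
  destruct (IH (eta / INR n ^ 3) l1) as [eta' [l' (He & C' & S')]].
  + lra.
  + split; [apply Rdiv_lt_0_compat; lra|].
    apply Rle_trans with (eta / 1); [|lra].
    apply Rmult_le_compat_l; [lra|]; apply Rinv_le_contravar; [lra|].
    rewrite <- (pow1 3); apply pow_incr; lra.
  + refine (covers_weaken _ _ _ _ _ _ _ _ C1).
    intros u Pu; split; [easy|]; destruct (C u Pu) as [k ?]; now exists k.
  + exists eta', l'; split; [easy|]; split; [easy|].
    eapply Rle_trans; [apply S'|].
    simpl pow; rewrite (Rmult_comm (exp _)), (Rmult_assoc _ (exp _)).
    apply Rmult_le_compat_l; [apply pow_le; left; apply exp_pos|].
    apply Rle_trans with (exp (- c0 * h + D * h ^ 2) * INR n ^ 9 * wsum (wt d) l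
       * (eta / INR n ^ 3) ^ 3).
    * apply Rmult_le_compat_r; [|easy].
      apply pow_le, Rdiv_le_0_compat; lra.
    * right; simpl; field; lra.
Qed.

Lemma bounded_past_fnull R0 : 0 <= R0 ->
  fnull (fun s q p => Rabs s <= R0 /\ Rabs q <= R0 /\
    forall T, 0 < T -> exists u, orbit g A B M T u /\
      ts u 0 = s /\ tq u 0 = q /\ tp u 0 = p).
Proof.
intros HR eps Heps.
assert (k0p : 0 < k0) by (unfold k0; lra).
assert (dp : 0 < d) by (apply Rdiv_lt_0_compat; nra).
assert (c0p : 0 < c0) by (apply Rmult_lt_0_compat; [easy | apply sqrt23]).
assert (Dp : 0 < D).
{ unfold D; assert (0 < K * M) by nra.
  apply Rplus_lt_le_0_compat; [nra|]; apply Rmult_le_pos; nra. }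
(* The first bound is the one required by the comparison of orbits, the second leaves a net rate of
   at least [c0 / 2]; [h] is fixed from here on. *)
set (h := Rmin (/ (18 * K)) (c0 / (2 * D))).
assert (h0 : 0 < h).
{ unfold h; apply Rmin_pos; [apply Rinv_0_lt_compat | apply Rdiv_lt_0_compat]; lra. }
assert (hh : h * K <= / 18).
{ apply Rle_trans with (/ (18 * K) * K); [|right; field; lra].
  apply Rmult_le_compat_r; [lra | apply Rmin_l]. }
assert (hD : D * h <= c0 / 2).
{ apply Rle_trans with (D * (c0 / (2 * D))); [|right; field; lra].
  apply Rmult_le_compat_l; [lra | apply Rmin_r]. }
assert (h1 : h < 1) by nra.
destruct (nat_above (/ h ^ 2)) as [n [_ [Hn _]]].
{ left; apply Rinv_0_lt_compat, pow_lt; lra. }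
assert (Hn' : 1 <= INR n * h ^ 2).
{ rewrite <- (Rinv_l (h ^ 2)); [|nra]; apply Rmult_le_compat_r; nra. }
set (W := exp (d * (M + 1))).
assert (W0 : 0 < W) by apply exp_pos.
(* With [T = INR j * h], the side [2 * H + h ^ 2] of the covered box is at most
   [2 * R0 + 2 * M + 1 + 6 * K * h * INR j]. One factor [W] turns the number of cubes at parameter
   [T] into weight, the other turns weight back into a number of cubes at 0. *)
destruct (exp_beats_cubic (c0 * h / 2) (2 * R0 + 2 * M + 1) (6 * K * h) (W * W) eps)
  as [j [j0 Hj]]; try nra.
set (T := INR j * h).
assert (jp : 0 < INR j) by now apply (lt_INR 0).
assert (T0 : 0 < T) by (unfold T; nra).
set (P := fun u => orbit g A B M T u /\ Rabs (ts u 0) <= R0 /\ Rabs (tq u 0) <= R0).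
set (H := R0 + M + 3 * K * T).
assert (Hend : forall u, P u -> Rabs (ts u T) <= H /\ Rabs (tq u T) <= H /\ Rabs (tp u T) <= H).
{ intros u (Hu & Hs & Hq).
  destruct (orbit_increments g A B K M hg hK hA hB T 0 T ltac:(lra) ltac:(lra) u 0 T Hu)
    as (Is & Iq & _); try lra.
  destruct (Hu T) as (_ & _ & _ & Mp); [lra|].
  rewrite Rminus_0_r in Is, Iq.
  assert (0 < K * T) by nra.
  apply Rabs_le_between in Is; apply Rabs_le_between in Iq; apply Rabs_le_between in Hs;
  apply Rabs_le_between in Hq; apply Rabs_le_between in Mp.
  unfold H; repeat split; apply Rabs_le; nra. }
destruct (box_cover P (fun u => ts u T) (fun u => tq u T) (fun u => tp u T) H (h ^ 2))
  as [l0 [C0 N0]]; [unfold H; nra | nra | easy |].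
(* A visited cube has its corner within 1 of a value of [phi] bounded by [M], hence the [M + 1] in
   [W]. *)
assert (wtW : forall e t k, 0 < e <= 1 -> 0 <= t <= T ->
  (exists u, P u /\ in_cube e k (ts u t) (tq u t) (tp u t)) -> / W <= wt d k <= W).
{ intros e t [[s q] p] He Ht [u [[Hu _] (_ & _ & Hp)]].
  destruct (Hu t Ht) as (_ & _ & _ & Mp); apply Rabs_le_between in Mp.
  assert (Rabs (tanh s * p) <= 1 * (M + 1)).
  { pose proof (tanh_bound s); apply Rabs_mul; apply Rabs_le; lra. }
  apply Rabs_le_between in H0.
  unfold W, wt; rewrite <- exp_Ropp; split; apply exp_mono; nra. }
destruct (cover_prune P _ _ _ _ (fun _ => 1) l0 ltac:(intros; lra) C0)
  as [l1 (C1 & N1 & E1)].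
rewrite !wsum_const in N1.
assert (h2 : h ^ 2 <= 1) by nra.
assert (S1 : wsum (wt d) l1 <= INR (length l1) * W).
{ rewrite <- wsum_const; apply wsum_le; intros k Hk.
  apply (wtW (h ^ 2) T); [nra | lra | now apply E1]. }
destruct (pull_back T h n P h0 hh Hn' ltac:(now intros u [Hu _]) j (h ^ 2) l1)
  as [e [l2 (He & C2 & S2)]]; [unfold T; lra | nra | exact C1 |].
destruct (cover_prune P _ _ _ _ (wt d) l2 ltac:(intros; left; apply wt_pos) C2)
  as [l3 (C3 & N3 & E3)].
assert (S3 : INR (length l3) * / W <= wsum (wt d) l3).
{ rewrite <- wsum_const; apply wsum_le; intros k Hk.
  apply (wtW e 0); [lra | lra | now apply E3]. }
exists e, l3; split; [lra|]; split.
- eapply Rle_lt_trans; [|apply Hj].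
  assert (e3 : 0 < e ^ 3) by (apply pow_lt; lra).
  assert (Q1 : INR (length l3) <= W * wsum (wt d) l2).
  { apply Rle_trans with (W * (INR (length l3) * / W)); [right; field; lra|].
    apply Rmult_le_compat_l; lra. }
  apply Rle_trans with (W * (wsum (wt d) l2 * e ^ 3)); [nra|].
  rewrite !(Rmult_assoc W); apply Rmult_le_compat_l; [lra|].
  eapply Rle_trans; [apply S2|].
  assert (h3 : 0 < (h ^ 2) ^ 3) by (apply pow_lt, pow_lt; lra).
  apply Rle_trans with (exp (- (c0 * h / 2)) ^ j * (W * (2 * H + h ^ 2) ^ 3)).
  + apply Rmult_le_compat.
    * apply pow_le; left; apply exp_pos.
    * apply Rmult_le_pos; [|lra].
      apply Rle_trans with (wsum (fun _ : cube => 0) l1).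
      -- rewrite wsum_const; lra.
      -- apply wsum_le; intros; left; apply wt_pos.
    * apply pow_incr; split; [left; apply exp_pos|].
      apply exp_mono; nra.
    * apply Rle_trans with (W * (INR (length l0) * (h ^ 2) ^ 3)); [|nra].
      apply Rle_trans with (INR (length l1) * W * (h ^ 2) ^ 3); [nra|].
      assert (INR (length l1) * (h ^ 2) ^ 3 <= INR (length l0) * (h ^ 2) ^ 3)
        by (apply Rmult_le_compat_r; lra).
      nra.
  + rewrite <- Rmult_assoc, (Rmult_comm _ W), Rmult_assoc, Rmult_assoc.
    apply Rmult_le_compat_l; [lra|]; apply Rmult_le_compat_l.
    * apply pow_le; left; apply exp_pos.
    * apply pow_incr; unfold H, T; split; [|lra].
      assert (0 < K * (INR j * h)) by (apply Rmult_lt_0_compat; nra); nra.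
- intros s q p (Hs & Hq & HT).
  destruct (HT T T0) as [u (Hu & <- & <- & <-)].
  apply (C3 u); now split.
Qed.
End Contraction.

(** * Global solutions of Lipschitz systems *)

Lemma continuous_of_lipschitz (f : R -> R) C :
  (forall t r, Rabs (f t - f r) <= C * Rabs (t - r)) -> forall t, continuous f t.
Proof.
intros H t; apply continuity_pt_filterlim; intros eps He.
assert (HC : 0 < Rabs C + 1) by (pose proof (Rabs_pos C); lra).
exists (eps / (Rabs C + 1)); split; [now apply Rdiv_lt_0_compat|].
intros r [_ Hr]; simpl in *; unfold R_dist in *.
eapply Rle_lt_trans; [apply H|].
apply Rle_lt_trans with ((Rabs C + 1) * Rabs (r - t)).
- apply Rmult_le_compat_r; [apply Rabs_pos|]; pose proof (Rle_abs C); lra.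
- apply Rlt_le_trans with ((Rabs C + 1) * (eps / (Rabs C + 1))).
  + now apply Rmult_lt_compat_l.
  + right; field; lra.
Qed.

Lemma derive_primitive (f : R -> R) : (forall t, continuous f t) ->
  forall t, derivable_pt_lim (fun x => RInt f 0 x) t (f t).
Proof.
intros Hf t; apply is_derive_Reals, is_derive_RInt with (a := 0); [|easy].
apply filter_forall; intros x; apply (@RInt_correct R_CompleteNormedModule).
apply (@ex_RInt_continuous R_CompleteNormedModule); auto.
Qed.

Lemma le_of_le_geometric x y c : (forall n, x <= y + c / 2 ^ n) -> x <= y.
Proof.
intros H.
destruct (Rle_dec x y) as [|N]; [easy|]; exfalso.
assert (Hc : 0 < c) by (specialize (H 0%nat); simpl in H; lra).
destruct (nat_above (c / (x - y))) as [n [_ [Hn _]]].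
{ apply Rdiv_le_0_compat; lra. }
assert (INR n < 2 ^ n).
{ clear; induction n as [|n IH]; [simpl; lra|]; rewrite S_INR.
  assert (1 <= 2 ^ n) by (apply pow_R1_Rle; lra); simpl; lra. }
specialize (H n).
assert (P2 : 0 < 2 ^ n) by (apply pow_lt; lra).
assert (c < (x - y) * 2 ^ n).
{ replace c with ((x - y) * (c / (x - y))) by (field; lra).
  apply Rmult_lt_compat_l; lra. }
assert (c / 2 ^ n < x - y); [|lra].
apply Rlt_div_l; lra.
Qed.

Lemma geometric_limit (a : nat -> R) C :
  (forall n, Rabs (a (S n) - a n) <= C / 2 ^ n) ->
  forall n, Rabs (real (Lim_seq a) - a n) <= 2 * C / 2 ^ n.
Proof.
intros H.
assert (P2 : forall n, 0 < 2 ^ n) by (intros; apply pow_lt; lra).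
assert (HC : 0 <= C).
{ specialize (H 0%nat); pose proof (Rabs_pos (a 1%nat - a 0%nat)); simpl in H; lra. }
assert (T : forall n k, Rabs (a (n + k)%nat - a n) <= 2 * C / 2 ^ n - 2 * C / 2 ^ (n + k)).
{ intros n k; induction k as [|k IH].
  - rewrite Nat.add_0_r, Rminus_diag, Rabs_R0; lra.
  - rewrite Nat.add_succ_r.
    replace (a (S (n + k)) - a n) with ((a (S (n + k)) - a (n + k)%nat)
      + (a (n + k)%nat - a n)) by ring.
    eapply Rle_trans; [apply Rabs_tri; [apply H | apply IH]|].
    right; simpl; field; split; apply Rgt_not_eq, P2. }
assert (T' : forall n k, Rabs (a (n + k)%nat - a n) <= 2 * C / 2 ^ n).
{ intros n k; eapply Rle_trans; [apply T|].
  assert (0 <= 2 * C / 2 ^ (n + k)) by (apply Rdiv_le_0_compat; [lra | apply P2]).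
  lra. }
assert (L : ex_finite_lim_seq a).
{ apply ex_lim_seq_cauchy_corr; intros eps.
  destruct (classic (forall n, pos eps <= 0 + 4 * C / 2 ^ n)) as [F|F].
  - apply le_of_le_geometric in F; destruct eps as [e He]; simpl in F; lra.
  - apply not_all_ex_not in F; destruct F as [N HN]; exists N; intros n m Hn Hm.
    replace (a n - a m) with ((a n - a N) - (a m - a N)) by ring.
    pose proof (T' N (n - N)%nat) as T1; pose proof (T' N (m - N)%nat) as T2.
    replace (N + (n - N))%nat with n in T1 by lia.
    replace (N + (m - N))%nat with m in T2 by lia.
    replace (4 * C / 2 ^ N) with (2 * C / 2 ^ N + 2 * C / 2 ^ N) in HN by
      (field; apply Rgt_not_eq, P2).
    apply Rabs_le_between in T1; apply Rabs_le_between in T2.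
    apply Rle_lt_trans with (2 * C / 2 ^ N + 2 * C / 2 ^ N); [|lra].
    apply Rabs_le; lra. }
apply Lim_seq_correct' in L.
intros n; apply Rabs_le.
assert (LS : is_lim_seq (fun k => a (n + k)%nat) (real (Lim_seq a))).
{ apply is_lim_seq_ext with (fun k => a (k + n)%nat).
  - intros k; now rewrite Nat.add_comm.
  - now apply is_lim_seq_incr_n. }
split.
- assert (X : Rbar_le (a n - 2 * C / 2 ^ n) (real (Lim_seq a))).
  { apply (is_lim_seq_le (fun _ => a n - 2 * C / 2 ^ n) (fun k => a (n + k)%nat));
      [|apply is_lim_seq_const|easy].
    intros k; pose proof (T' n k) as X; apply Rabs_le_between in X; lra. }
  simpl in X; lra.
- assert (X : Rbar_le (real (Lim_seq a)) (a n + 2 * C / 2 ^ n)).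
  { apply (is_lim_seq_le (fun k => a (n + k)%nat) (fun _ => a n + 2 * C / 2 ^ n));
      [|easy|apply is_lim_seq_const].
    intros k; pose proof (T' n k) as X; apply Rabs_le_between in X; lra. }
  simpl in X; lra.
Qed.

Section Picard.
Variables (I : Type) (F : (I -> R) -> I -> R) (L C : R) (x0 : I -> R).
Hypotheses (hL : 1 <= L) (hC : 0 <= C) (hF : forall x i, Rabs (F x i) <= C)
  (hLip : forall e x y, (forall i, Rabs (x i - y i) <= e) ->
     forall i, Rabs (F x i - F y i) <= L * e).

(** The sup norm over [I] is never formed: closeness of two states is a common bound [e] on all
    components, as in [hLip]. *)
Fixpoint picard (n : nat) (t : R) (i : I) : R :=
  match n with
  | O => x0 i
  | S n => x0 i + RInt (fun r => F (picard n r) i) 0 t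
  end.

Lemma picard_props n :
  (forall t r i, Rabs (picard n t i - picard n r i) <= C * Rabs (t - r)) /\
  (forall i t, derivable_pt_lim (fun r => picard (S n) r i) t (F (picard n t) i)).
Proof.
assert (X : forall n,
  (forall t r i, Rabs (picard n t i - picard n r i) <= C * Rabs (t - r)) ->
  (forall i t, derivable_pt_lim (fun r => picard (S n) r i) t (F (picard n t) i))).
{ intros m Hm i t; simpl.
  rewrite <- (Rplus_0_l (F _ _)).
  apply derivable_pt_lim_plus; [apply derivable_pt_lim_const|].
  apply (derive_primitive (fun r => F (picard m r) i)).
  apply continuous_of_lipschitz with (C := L * C); intros.
  rewrite Rmult_assoc; apply hLip; intros j; apply Hm. }
assert (Y : forall t r i, Rabs (picard n t i - picard n r i) <= C * Rabs (t - r)).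
{ induction n as [|n IH].
  - intros; simpl; rewrite Rminus_diag, Rabs_R0.
    apply Rmult_le_pos; [easy | apply Rabs_pos].
  - intros t r i.
    apply (lipschitz_of_derive (fun r => picard (S n) r i) (fun t => F (picard n t) i));
      intros; [now apply X | apply hF]. }
split; [exact Y | now apply X].
Qed.

Lemma picard_0 n i : picard n 0 i = x0 i.
Proof. destruct n; simpl; [easy|]; rewrite RInt_point; apply Rplus_0_r. Qed.

(** Relative to the weight [exp (2 * L * t)] the Picard operator contracts by one half, so
    convergence holds on the whole half-line without patching short intervals. The bound propagates
    by comparing derivatives: [G + D] and [G - D] are nondecreasing. *)
Lemma picard_increment n : forall t i, 0 <= t ->
  Rabs (picard (S n) t i - picard n t i) <= C * exp (2 * L * t) / 2 ^ n.
Proof.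
induction n as [|n IH]; intros t i Ht.
- destruct (mean_value (fun r => picard 1 r i) (fun r => F (picard 0 r) i) 0 t)
    as [c [_ E]]; [intros; apply (picard_props 0)|].
  cbv beta in E; rewrite picard_0 in E; simpl picard at 2.
  rewrite E, Rabs_mult, Rminus_0_r, (Rabs_pos_eq t Ht), pow_O, Rdiv_1_r.
  apply Rmult_le_compat; auto using Rabs_pos.
  pose proof (exp_ineq1_le (2 * L * t)); nra.
- set (D := fun r => picard (S (S n)) r i - picard (S n) r i).
  set (G := fun r => C / 2 ^ S n * exp (2 * L * r)).
  set (D' := fun r => F (picard (S n) r) i - F (picard n r) i).
  set (G' := fun r => L * (C * exp (2 * L * r) / 2 ^ n)).
  assert (P2 : 0 < 2 ^ n) by (apply pow_lt; lra).
  assert (HD : forall r, derivable_pt_lim D r (D' r)).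
  { intros r; apply derivable_pt_lim_minus; apply picard_props. }
  assert (HG : forall r, derivable_pt_lim G r (G' r)).
  { intros r; apply is_derive_Reals; unfold G, G'; auto_derive; [easy|].
    simpl; field; lra. }
  assert (D0 : D 0 = 0) by (unfold D; rewrite !picard_0; ring).
  assert (G0 : 0 <= G 0).
  { apply Rmult_le_pos; [|left; apply exp_pos].
    apply Rdiv_le_0_compat; [lra | apply pow_lt; lra]. }
  assert (Bd : forall r, 0 <= r -> Rabs (D' r) <= G' r).
  { intros r Hr; apply hLip; intros j; now apply IH. }
  replace (C * exp (2 * L * t) / 2 ^ S n) with (G t)
    by (unfold G; simpl; field; lra).
  fold (D t); apply Rabs_le; split.
  + destruct (mean_value (fun r => G r + D r) (fun r => G' r + D' r) 0 t) as [c [Hc E]].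
    { intros; now apply derivable_pt_lim_plus. }
    rewrite Rmin_left, Rmax_right in Hc by lra.
    pose proof (Bd c ltac:(lra)) as X; apply Rabs_le_between in X.
    assert (0 <= (G' c + D' c) * (t - 0)) by (apply Rmult_le_pos; lra); lra.
  + destruct (mean_value (fun r => G r - D r) (fun r => G' r - D' r) 0 t) as [c [Hc E]].
    { intros; now apply derivable_pt_lim_minus. }
    rewrite Rmin_left, Rmax_right in Hc by lra.
    pose proof (Bd c ltac:(lra)) as X; apply Rabs_le_between in X.
    assert (0 <= (G' c - D' c) * (t - 0)) by (apply Rmult_le_pos; lra); lra.
Qed.

(* The solution is continued to [t < 0] as the primitive of a continuous
   extension of its derivative, so that it has a two-sided derivative at 0. *)
Lemma global_solution : exists u : R -> I -> R,
  (forall i, u 0 i = x0 i) /\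
  (forall t i, 0 <= t -> derivable_pt_lim (fun r => u r i) t (F (u t) i)).
Proof.
(* Negative times are sent to 0, because the increments are controlled for [t >= 0] only. *)
set (v := fun t i => real (Lim_seq (fun n => picard n (Rmax 0 t) i))).
assert (Hv : forall t n i, Rabs (v t i - picard n (Rmax 0 t) i)
   <= 2 * (C * exp (2 * L * Rmax 0 t)) / 2 ^ n).
{ intros t n i; apply (geometric_limit (fun n => picard n (Rmax 0 t) i)).
  intros m; apply picard_increment, Rmax_l. }
assert (Hmax : forall t r, Rabs (Rmax 0 t - Rmax 0 r) <= Rabs (t - r)).
{ intros t r; unfold Rmax; destruct (Rle_dec 0 t), (Rle_dec 0 r);
  apply Rabs_le; unfold Rabs; destruct Rcase_abs; lra. }
assert (Lv : forall t r i, Rabs (v t i - v r i) <= C * Rabs (t - r)).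
{ intros t r i; apply le_of_le_geometric with
    (2 * (C * exp (2 * L * Rmax 0 t)) + 2 * (C * exp (2 * L * Rmax 0 r))).
  intros n; replace (v t i - v r i) with
    ((picard n (Rmax 0 t) i - picard n (Rmax 0 r) i) +
     ((v t i - picard n (Rmax 0 t) i) + - (v r i - picard n (Rmax 0 r) i))) by ring.
  rewrite Rdiv_plus_distr; apply Rabs_tri; [|apply Rabs_tri; [apply Hv|]].
  - eapply Rle_trans; [apply picard_props|]; apply Rmult_le_compat_l; auto.
  - rewrite Rabs_Ropp; apply Hv. }
assert (Dw : forall i t, derivable_pt_lim
   (fun r => x0 i + RInt (fun z => F (v z) i) 0 r) t (F (v t) i)).
{ intros i t; rewrite <- (Rplus_0_l (F _ _)).
  apply derivable_pt_lim_plus; [apply derivable_pt_lim_const|].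
  apply (derive_primitive (fun r => F (v r) i)).
  apply continuous_of_lipschitz with (C := L * C); intros.
  rewrite Rmult_assoc; apply hLip; intros j; apply Lv. }
exists (fun t i => x0 i + RInt (fun r => F (v r) i) 0 t); split.
{ intros i; rewrite RInt_point; apply Rplus_0_r. }
intros t i Ht.
assert (Ev : forall j, x0 j + RInt (fun r => F (v r) j) 0 t = v t j).
(* Both sides are within a multiple of [/ 2 ^ n] of [picard (S n)]: the integral because [v] is
   close to [picard n], and [v] by construction. *)
{ intros j; apply Rminus_diag_uniq, Rabs_eq_0, Rle_antisym; [|apply Rabs_pos].
  set (c := 2 * (C * exp (2 * L * t))).
  apply le_of_le_geometric with (L * c * t + c); intros n; rewrite Rplus_0_l.
  assert (P2 : 0 < 2 ^ n) by (apply pow_lt; lra).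
  assert (c0 : 0 <= c).
  { unfold c; pose proof (exp_pos (2 * L * t)); nra. }
  replace (_ - v t j) with ((x0 j + RInt (fun r => F (v r) j) 0 t - picard (S n) t j)
    + - (v t j - picard (S n) t j)) by ring.
  rewrite Rdiv_plus_distr; apply Rabs_tri.
  - pose proof (lipschitz_of_derive
      (fun r => x0 j + RInt (fun r => F (v r) j) 0 r - picard (S n) r j)
      (fun r => F (v r) j - F (picard n r) j) (L * (c / 2 ^ n)) 0 t) as X.
    cbv beta in X; rewrite picard_0, RInt_point, !Rminus_0_r, (Rabs_pos_eq t Ht) in X.
    change (@zero R_CompleteNormedModule) with 0 in X.
    replace (x0 j + 0 - x0 j) with 0 in X by ring; rewrite Rminus_0_r in X.
    replace (L * c * t / 2 ^ n) with (L * (c / 2 ^ n) * t) by (field; lra).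
    apply X.
    + intros r _; apply derivable_pt_lim_minus; [apply Dw | apply picard_props].
    + intros r; rewrite Rmin_left, Rmax_right by lra; intros Hr; apply hLip; intros k.
      specialize (Hv r n k); rewrite Rmax_right in Hv by lra.
      eapply Rle_trans; [apply Hv|].
      apply Rmult_le_compat_r; [left; now apply Rinv_0_lt_compat|].
      unfold c; apply Rmult_le_compat_l; [lra|]; apply Rmult_le_compat_l; [easy|].
      apply exp_mono; nra.
  - rewrite Rabs_Ropp; specialize (Hv t (S n) j); rewrite Rmax_right in Hv by lra.
    eapply Rle_trans; [apply Hv|]; fold c; apply Rmult_le_compat_l; [easy|].
    apply Rinv_le_contravar; [easy|]; simpl; lra. }
replace (F _ i) with (F (v t) i); [apply Dw|].
(* The two states agree component by component, so [hLip] with bound 0 identifies the values of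
   [F]. *)
apply Rminus_diag_uniq, Rabs_eq_0, Rle_antisym; [|apply Rabs_pos].
apply Rle_trans with (L * 0); [apply hLip; intros j | lra].
rewrite Ev, Rminus_diag, Rabs_R0; lra.
Qed.
End Picard.

(** * Null sets for the three-dimensional measure *)

Definition in_ball (c : R * R * R * R) (r x y z p : R) : Prop :=
  let '(c1, c2, c3, c4) := c in
  (x - c1) ^ 2 + (y - c2) ^ 2 + (z - c3) ^ 2 + (p - c4) ^ 2 < r ^ 2.

(* Like [H3_null], but allowing empty balls, of radius 0. *)
Definition weak_null (N : R -> R -> R -> R -> Prop) : Prop :=
  forall eps, 0 < eps -> exists (c : nat -> R * R * R * R) (r : nat -> R),
    (forall n, 0 <= r n) /\ (forall n, sum_f_R0 (fun k => r k ^ 3) n <= eps) /\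
    (forall x y z p, N x y z p -> exists n, in_ball (c n) (r n) x y z p).

Lemma sum_geometric d n : 0 <= d -> sum_f_R0 (fun k => d / 2 ^ k) n <= 2 * d.
Proof.
intros Hd; assert (P2 : forall n, 0 < 2 ^ n) by (intros; apply pow_lt; lra).
enough (E : sum_f_R0 (fun k => d / 2 ^ k) n = 2 * d - d / 2 ^ n).
{ assert (0 <= d / 2 ^ n) by (apply Rdiv_le_0_compat; auto); lra. }
induction n as [|n IH]; [simpl; field|].
rewrite tech5, IH; simpl; field; apply Rgt_not_eq, P2.
Qed.

Lemma weak_null_H3_null N : weak_null N -> H3_null N.
Proof.
intros H eps He; destruct (H (eps / 16)) as (c & r & Hr & Hs & Hc); [lra|].
(* Radii are enlarged by [d / 2 ^ n]. Since [(a + b) ^ 3 <= 4 * a ^ 3 + 4 * b ^ 3] and [a ^ 3 <= a]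
   for [a <= 1], the total is at most [4 * (eps / 16) + 8 * d], which is below [eps]. *)
set (d := Rmin 1 (eps / 16)).
assert (Hd : 0 < d <= 1) by (split; [apply Rmin_pos; lra | apply Rmin_l]).
assert (Hd' : d <= eps / 16) by apply Rmin_r.
assert (P2 : forall n, 1 <= 2 ^ n) by (intros; apply pow_R1_Rle; lra).
assert (Hdn : forall n, 0 < d / 2 ^ n).
{ intros n; specialize (P2 n); apply Rdiv_lt_0_compat; lra. }
exists (fun n => fst (fst (fst (c n)))), (fun n => snd (fst (fst (c n)))),
  (fun n => snd (fst (c n))), (fun n => snd (c n)), (fun n => r n + d / 2 ^ n).
repeat split.
- intros n; specialize (Hr n); specialize (Hdn n); lra.
- intros n; apply Rle_lt_trans with
    (4 * sum_f_R0 (fun k => r k ^ 3) n + 4 * sum_f_R0 (fun k => d / 2 ^ k) n).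
  + rewrite !scal_sum, <- sum_plus; apply sum_Rle; intros k _.
    specialize (Hr k); specialize (Hdn k); specialize (P2 k).
    set (a := d / 2 ^ k) in *; set (b := r k) in *.
    assert (a <= 1).
    { apply Rle_trans with (d / 1); [|lra].
      apply Rmult_le_compat_l; [lra|]; apply Rinv_le_contravar; lra. }
    assert (a ^ 3 <= a) by nra.
    assert (0 <= (a + b) * (a - b) ^ 2)
      by (apply Rmult_le_pos; [lra | apply pow2_ge_0]).
    nra.
  + pose proof (sum_geometric d n); specialize (Hs n); lra.
- intros x y z p HN; destruct (Hc x y z p HN) as [n Hn]; exists n.
  destruct (c n) as [[[c1 c2] c3] c4]; unfold in_ball in Hn; cbn [fst snd].
  eapply Rlt_le_trans; [exact Hn|].
  apply pow_incr; specialize (Hr n); specialize (Hdn n); lra.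
Qed.

Lemma wsum_seq (w : nat -> R) n : sum_f_R0 w n = wsum w (seq 0 (S n)).
Proof.
induction n as [|n IH]; [simpl; ring|].
rewrite tech5, IH, (seq_S (S n) 0), wsum_app; simpl; ring.
Qed.

Lemma wsum_map {I J} (w : J -> R) (f : I -> J) l :
  wsum w (map f l) = wsum (fun i => w (f i)) l.
Proof. induction l as [|i l IH]; simpl; [easy | now rewrite IH]. Qed.

Lemma wsum_prod {I J} (w : I * J -> R) l l' :
  wsum w (list_prod l l') = wsum (fun i => wsum (fun j => w (i, j)) l') l.
Proof.
induction l as [|i l IH]; simpl; [easy|].
now rewrite wsum_app, wsum_map, IH.
Qed.

Lemma wsum_incl {I} (w : I -> R) l : (forall i, 0 <= w i) -> NoDup l ->
  forall l', incl l l' -> wsum w l <= wsum w l'.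
Proof.
intros Hw; induction 1 as [|i l Hi Hl IH]; intros l' Hincl.
- simpl; induction l'; simpl; [lra|].
  assert (wsum w l' >= 0) by (apply Rle_ge, IHl'; intros ? []).
  specialize (Hw a); lra.
- destruct (in_split i l') as (l1 & l2 & ->); [apply Hincl; now left|].
  assert (X : wsum w l <= wsum w (l1 ++ l2)).
  { apply IH; intros j Hj.
    destruct (in_app_or l1 (i :: l2) j) as [|[<-|]]; [apply Hincl; now right| | |];
      try (apply in_or_app; auto); easy. }
  rewrite wsum_app in *; simpl; lra.
Qed.

Lemma weak_null_union (N : nat -> R -> R -> R -> R -> Prop) :
  (forall i, weak_null (N i)) -> weak_null (fun x y z p => exists i, N i x y z p).
Proof.
intros H eps He.
assert (P2 : forall n, 0 < 2 ^ n) by (intros; apply pow_lt; lra).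
destruct (functional_choice (fun (i : nat) (cr : (nat -> R * R * R * R) * (nat -> R)) =>
  (forall n, 0 <= snd cr n) /\
  (forall n, sum_f_R0 (fun k => snd cr k ^ 3) n <= eps / 2 / 2 ^ i) /\
  (forall x y z p, N i x y z p -> exists n, in_ball (fst cr n) (snd cr n) x y z p)))
  as [f Hf].
{ intros i; destruct (H i (eps / 2 / 2 ^ i)) as (c & r & ?).
  - apply Rdiv_lt_0_compat; [lra | apply P2].
  - now exists (c, r). }
exists (fun n => fst (f (fst (Cantor.of_nat n))) (snd (Cantor.of_nat n))),
  (fun n => snd (f (fst (Cantor.of_nat n))) (snd (Cantor.of_nat n))).
repeat split.
- intros n; apply Hf.
- intros n; rewrite wsum_seq.
  set (w := fun ij : nat * nat => snd (f (fst ij)) (snd ij) ^ 3).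
  apply Rle_trans with (wsum w (map Cantor.of_nat (seq 0 (S n)))).
  { rewrite wsum_map; apply Rle_refl. }
  (* The first [S n] pairs of the Cantor enumeration are distinct and lie in a square of side [S n],
     because the code of a pair is at least the sum of its entries. *)
  apply Rle_trans with (wsum w (list_prod (seq 0 (S n)) (seq 0 (S n)))).
  { apply wsum_incl.
    - intros i; apply pow_le, Hf.
    - apply Injective_map_NoDup; [|apply seq_NoDup].
      intros i j E; rewrite <- (Cantor.cancel_to_of i), E; apply Cantor.cancel_to_of.
    - intros [i j] Hij; apply in_map_iff in Hij; destruct Hij as (k & E & Hk).
      apply in_seq in Hk.
      pose proof (Cantor.to_nat_non_decreasing i j) as X.
      rewrite <- E, Cantor.cancel_to_of in X.
      apply in_prod; apply in_seq; lia. }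
  rewrite wsum_prod.
  apply Rle_trans with (wsum (fun i => eps / 2 / 2 ^ i) (seq 0 (S n))).
  + apply wsum_le; intros i _; rewrite <- wsum_seq.
    destruct (Hf i) as (_ & Hs & _); apply Hs.
  + rewrite <- wsum_seq; pose proof (sum_geometric (eps / 2) n); lra.
- intros x y z p [i Hi]; destruct (Hf i) as (_ & _ & Hc).
  destruct (Hc x y z p Hi) as [j Hj].
  exists (Cantor.to_nat (i, j)); now rewrite Cantor.cancel_of_to.
Qed.

Lemma weak_null_subset (N N' : R -> R -> R -> R -> Prop) :
  (forall x y z p, N x y z p -> N' x y z p) -> weak_null N' -> weak_null N.
Proof.
intros H H' eps He; destruct (H' eps He) as (c & r & ? & ? & Hc).
exists c, r; repeat split; auto.
Qed.

Lemma sum_indicator_le q N n : 0 <= q ->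
  sum_f_R0 (fun k => if (k <? N)%nat then q else 0) n <= INR N * q.
Proof.
intros Hq.
enough (X : sum_f_R0 (fun k => if (k <? N)%nat then q else 0) n
   <= INR (Nat.min (S n) N) * q).
{ eapply Rle_trans; [exact X|]; apply Rmult_le_compat_r; [easy|].
  apply le_INR; lia. }
induction n as [|n IH].
- destruct N; simpl; lra.
- rewrite tech5; destruct (Nat.ltb_spec (S n) N).
  + replace (Nat.min (S (S n)) N) with (S (Nat.min (S n) N)) by lia.
    rewrite S_INR; lra.
  + replace (Nat.min (S (S n)) N) with (Nat.min (S n) N) by lia; lra.
Qed.

Lemma list_choice {I J} (Q : I -> J -> Prop) l :
  (forall i, In i l -> exists j, Q i j) -> exists l', Forall2 Q l l'.
Proof.
induction l as [|i l IH]; intros H; [now exists nil|].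
destruct (H i) as [j Hj]; [now left|].
destruct IH as [l' Hl']; [intros; apply H; now right|].
exists (j :: l'); now constructor.
Qed.

Lemma Forall2_in_l {I J} (Q : I -> J -> Prop) l l' i : Forall2 Q l l' -> In i l ->
  exists n, (n < length l')%nat /\ forall d, Q i (nth n l' d).
Proof.
induction 1 as [|a b l l' Hab Hl IH]; [easy|]; intros [<-|Hi].
- exists 0%nat; simpl; split; [lia | easy].
- destruct (IH Hi) as (n & Hn & HQ); exists (S n); simpl; split; [lia | easy].
Qed.

(** Every visited cube contains a chosen point of [E], whose image is the centre of a ball. Pruning
    is essential, since the Lipschitz bound is assumed on [E] alone. *)
Lemma fnull_image (E : R -> R -> R -> Prop) (f1 f2 f3 f4 : R -> R -> R -> R) L :
  0 < L ->
  (forall e s q p s' q' p', E s q p -> E s' q' p' ->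
    Rabs (s - s') <= e -> Rabs (q - q') <= e -> Rabs (p - p') <= e ->
    Rabs (f1 s q p - f1 s' q' p') <= L * e /\ Rabs (f2 s q p - f2 s' q' p') <= L * e /\
    Rabs (f3 s q p - f3 s' q' p') <= L * e /\ Rabs (f4 s q p - f4 s' q' p') <= L * e) ->
  fnull E ->
  weak_null (fun x y z p => exists a b c, E a b c /\
    x = f1 a b c /\ y = f2 a b c /\ z = f3 a b c /\ p = f4 a b c).
Proof.
intros HL Hf HE eps He.
destruct (HE (eps / (3 * L) ^ 3)) as (e & l0 & He0 & Hl0 & Hc0).
{ apply Rdiv_lt_0_compat; [easy | apply pow_lt; lra]. }
set (P := fun u : R * R * R => let '(a, b, c) := u in E a b c).
set (pa := fun u : R * R * R => fst (fst u)); set (pb := fun u : R * R * R => snd (fst u)).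
destruct (cover_prune P pa pb snd e (fun _ => 1) l0) as (l & Hc & Hl & Hne).
{ intros; lra. }
{ intros [[a b] c] Hu; apply (Hc0 a b c Hu). }
rewrite !wsum_const, !Rmult_1_r in Hl.
destruct (list_choice (fun k u => P u /\ in_cube e k (pa u) (pb u) (snd u)) l Hne)
  as [lu Hlu].
set (g := fun u : R * R * R => let '(a, b, c) := u in
  (f1 a b c, f2 a b c, f3 a b c, f4 a b c)).
exists (fun n => g (nth n lu (0, 0, 0))),
  (* Four coordinates differing by at most [L * e] give distance at most [2 * L * e]; the radius
     [3 * L * e] makes the inequality strict. Indices past the list get radius 0. *)
  (fun n => if (n <? length lu)%nat then 3 * L * e else 0).
assert (L3 : 0 < 3 * L * e) by nra.
repeat split.
- intros n; destruct (n <? length lu)%nat; lra.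
- intros n; apply Rle_trans with
    (sum_f_R0 (fun k => if (k <? length lu)%nat then (3 * L * e) ^ 3 else 0) n).
  { apply sum_Rle; intros k _; destruct (k <? length lu)%nat; simpl; lra. }
  eapply Rle_trans; [apply sum_indicator_le, pow_le; lra|].
  rewrite <- (Forall2_length Hlu).
  assert (L30 : 0 < (3 * L) ^ 3) by (apply pow_lt; lra).
  replace ((3 * L * e) ^ 3) with (e ^ 3 * (3 * L) ^ 3) by ring.
  replace eps with (eps / (3 * L) ^ 3 * (3 * L) ^ 3) by (field; lra).
  rewrite <- Rmult_assoc; apply Rmult_le_compat_r; [lra|].
  assert (0 < e ^ 3) by (apply pow_lt; lra).
  eapply Rle_trans; [apply Rmult_le_compat_r; [lra | apply Hl] | lra].
- intros x y z p (a & b & c & Habc & -> & -> & -> & ->).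
  destruct (Hc (a, b, c) Habc) as (k & Hk & Hin).
  destruct (Forall2_in_l _ _ _ _ Hlu Hk) as (n & Hn & HQ).
  exists n; rewrite (proj2 (Nat.ltb_lt _ _) Hn).
  destruct (HQ (0, 0, 0)) as [HP Hin'].
  destruct (nth n lu (0, 0, 0)) as [[a' b'] c'].
  destruct (in_cube_close _ _ _ _ _ _ _ _ Hin Hin') as (D1 & D2 & D3).
  simpl in HP, D1, D2, D3 |- *.
  destruct (Hf e a b c a' b' c' Habc HP D1 D2 D3) as (X1 & X2 & X3 & X4).
  rewrite !Rmult_1_r.
  assert (sq : forall v, Rabs v <= L * e -> v * v <= (L * e) * (L * e)).
  { intros v Hv; apply Rabs_le_between in Hv; nra. }
  apply sq in X1; apply sq in X2; apply sq in X3; apply sq in X4.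
  assert (0 < L * e) by nra; nra.
Qed.

(** A flat square takes about [/ e ^ 2] cubes, hence volume of order [e]. This disposes of the two
    faces of the state space, where one angle is constant. *)
Lemma planar_fnull H b0 : 0 <= H ->
  fnull (fun a b c => Rabs a <= H /\ b = b0 /\ Rabs c <= H).
Proof.
intros HH eps He.
set (D := (2 * H + 1) * (2 * H + 1)).
assert (HD : 0 < D) by (unfold D; nra).
set (e := Rmin 1 (eps / (2 * D))).
assert (e0 : 0 < e) by (apply Rmin_pos; [lra|]; apply Rdiv_lt_0_compat; lra).
assert (e1 : e <= 1) by apply Rmin_l.
assert (e2 : D * e <= eps / 2).
{ apply Rle_trans with (D * (eps / (2 * D))); [|right; field; lra].
  apply Rmult_le_compat_l; [lra | apply Rmin_r]. }
destruct (nat_above (2 * H / e)) as [n [n0 Hn]].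
{ apply Rdiv_le_0_compat; lra. }
assert (Hne : 2 * H <= INR n * e <= 2 * H + e).
{ replace (2 * H) with (2 * H / e * e) by (field; lra); split; nra. }
exists e, (map (fun ij : nat * nat => (- H + INR (fst ij) * e, b0, - H + INR (snd ij) * e))
   (list_prod (seq 0 n) (seq 0 n))).
split; [easy|]; split.
- rewrite length_map, length_prod, !length_seq, mult_INR.
  replace (INR n * INR n * e ^ 3) with ((INR n * e) * (INR n * e) * e) by ring.
  assert ((INR n * e) * (INR n * e) <= D).
  { unfold D; apply Rmult_le_compat; lra. }
  apply Rle_lt_trans with (D * e); [apply Rmult_le_compat_r|]; lra.
- intros a b c (Ha & -> & Hc).
  apply Rabs_le_between in Ha; apply Rabs_le_between in Hc.
  destruct (grid_index a (- H) e n n0) as [i [Hi Hi']]; [lra|].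
  destruct (grid_index c (- H) e n n0) as [k [Hk Hk']]; [lra|].
  exists (- H + INR i * e, b0, - H + INR k * e); split.
  + apply in_map_iff; exists (i, k); split; [easy|]; apply in_prod; apply in_seq; lia.
  + repeat split; lra.
Qed.

(** * Images of null sets under the parametrisations *)

Definition unit_lip (f : R -> R) : Prop :=
  (forall t, Rabs (f t) <= 1) /\ (forall t r, Rabs (f t - f r) <= Rabs (t - r)).

Lemma unit_lip_of_derive f f' : (forall t, Rabs (f t) <= 1) ->
  (forall t, derivable_pt_lim f t (f' t)) -> (forall t, Rabs (f' t) <= 1) ->
  unit_lip f.
Proof.
intros H H' H''; split; [easy|]; intros t r; rewrite <- (Rmult_1_l (Rabs (t - r))).
apply lipschitz_of_derive with f'; auto.
Qed.

(** The common shape of both parametrisations: [sech], [tanh], [lc], [ls] for the interior and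
    [sin], [cos], [cos], [sin] for the faces. *)
Lemma warped_null (E : R -> R -> R -> Prop) al a1 a2 b1 b3 K M :
  1 <= K -> lip_on K M al ->
  unit_lip a1 -> unit_lip a2 -> unit_lip b1 -> unit_lip b3 ->
  (forall s q p, E s q p -> Rabs p <= M) -> fnull E ->
  weak_null (fun x y z p => exists s q, E s q p /\
    x = al p * (a1 s * b1 q) /\ y = a2 s /\ z = a1 s * b3 q).
Proof.
intros HK [Hal Hal'] [A1 A1'] [A2 A2'] [B1 B1'] [B3 B3'] HM HE.
apply weak_null_subset with (fun x y z p => exists a b c, E a b c /\
    x = al c * (a1 a * b1 b) /\ y = a2 a /\ z = a1 a * b3 b /\ p = c).
{ intros x y z p (s & q & ? & ? & ? & ?); now exists s, q, p. }
assert (prod : forall u v u' v' e, Rabs u' <= 1 -> Rabs v <= 1 ->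
  Rabs (u - u') <= e -> Rabs (v - v') <= e -> Rabs (u * v - u' * v') <= 2 * e).
{ intros u v u' v' e ? ? ? ?.
  replace (u * v - u' * v') with ((u - u') * v + u' * (v - v')) by ring.
  replace (2 * e) with (e * 1 + 1 * e) by ring.
  apply Rabs_tri; now apply Rabs_mul. }
apply (fnull_image E (fun a b c => al c * (a1 a * b1 b)) (fun a _ _ => a2 a)
  (fun a b _ => a1 a * b3 b) (fun _ _ c => c) (3 * K)); [lra| |easy].
intros e s q p s' q' p' H1 H2 Hs Hq Hp.
assert (0 <= e) by (eapply Rle_trans; [apply Rabs_pos | exact Hs]).
assert (HKe : e <= K * e) by nra.
repeat split.
- replace (al p * (a1 s * b1 q) - al p' * (a1 s' * b1 q'))
    with ((al p - al p') * (a1 s * b1 q) + al p' * (a1 s * b1 q - a1 s' * b1 q')) by ring.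
  replace (3 * K * e) with (K * e * (1 * 1) + K * (2 * e)) by ring.
  apply Rabs_tri; apply Rabs_mul.
  + eapply Rle_trans; [apply Hal'; eauto|]; apply Rmult_le_compat_l; lra.
  + now apply Rabs_mul.
  + eauto.
  + apply prod; auto; eapply Rle_trans; eauto.
- eapply Rle_trans; [apply A2'|]; lra.
- eapply Rle_trans; [apply (prod _ _ _ _ e); auto; eapply Rle_trans; eauto|]; lra.
- lra.
Qed.

(** * Regularity of the coefficients and of the coordinates *)

Lemma lip_on_mono K K' M A : K <= K' -> lip_on K M A -> lip_on K' M A.
Proof.
intros HK [H H']; split.
- intros p Hp; eapply Rle_trans; [now apply H | easy].
- intros p p' Hp Hp'; eapply Rle_trans; [now apply H'|].
  apply Rmult_le_compat_r; [apply Rabs_pos | easy].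
Qed.

Lemma bounded_on f M : 0 <= M -> continuity f ->
  exists K, forall p, Rabs p <= M -> Rabs (f p) <= K.
Proof.
intros HM Hf; destruct (continuity_ab_maj (fun p => Rabs (f p)) (- M) M) as [m [Hm _]].
- lra.
- intros c _; apply (continuity_pt_comp f Rabs); [apply Hf | apply Rcontinuity_abs].
- exists (Rabs (f m)); intros p Hp; apply Hm; now apply Rabs_le_between.
Qed.

Lemma lip_on_of_derive A A' M : 0 <= M ->
  (forall t, derivable_pt_lim A t (A' t)) -> continuity A' ->
  exists K, 1 <= K /\ lip_on K M A.
Proof.
intros HM HA HA'.
assert (CA : continuity A).
{ intros t; apply derivable_continuous_pt; exists (A' t); apply HA. }
destruct (bounded_on A M HM CA) as [K1 H1].
destruct (bounded_on A' M HM HA') as [K2 H2].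
exists (1 + Rabs K1 + Rabs K2).
pose proof (Rabs_pos K1); pose proof (Rabs_pos K2).
pose proof (Rle_abs K1); pose proof (Rle_abs K2).
split; [lra | split].
- intros p Hp; specialize (H1 p Hp); lra.
- intros p p' Hp Hp'; apply lipschitz_of_derive with A'; [auto|].
  intros t Ht; apply Rle_trans with K2; [apply H2|lra].
  apply Rabs_le_between in Hp; apply Rabs_le_between in Hp'; apply Rabs_le.
  unfold Rmin, Rmax in Ht; destruct (Rle_dec p' p); lra.
Qed.

Lemma C3_continuity f f1 f2 f3 : C3 f f1 f2 f3 ->
  continuity f /\ continuity f1 /\ continuity f2.
Proof.
intros (H1 & H2 & H3 & _); repeat split; intros t; apply derivable_continuous_pt;
  eexists; [apply H1 | apply H2 | apply H3].
Qed.

Lemma log_derivative_lip f f1 f2 f3 k M : 0 <= M -> C3 f f1 f2 f3 ->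
  (forall t, 0 < f t) ->
  exists K, 1 <= K /\ lip_on K M (fun p => k * (f1 p / f p)).
Proof.
intros HM Hf Hpos; destruct (C3_continuity _ _ _ _ Hf) as (C0 & C1 & C2).
destruct Hf as (D1 & D2 & _).
apply lip_on_of_derive with
  (A' := fun t => k * ((f2 t * f t - f1 t * f1 t) / (f t * f t))); [easy| |].
- intros t; apply derivable_pt_lim_scal.
  apply (derivable_pt_lim_div f1 f t (f2 t) (f1 t)); auto.
  specialize (Hpos t); lra.
- intros t; apply continuity_pt_scal.
  apply (continuity_pt_div (fun t => f2 t * f t - f1 t * f1 t) (fun t => f t * f t)).
  + apply (continuity_pt_minus (fun t => f2 t * f t) (fun t => f1 t * f1 t));
      apply continuity_pt_mult; auto.
  + apply continuity_pt_mult; auto.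
  + specialize (Hpos t); nra.
Qed.

Definition al (V : R -> R) (p : R) : R := sqrt (3 / V p).

Lemma derive_al V V1 : (forall t, 0 < V t) ->
  (forall t, derivable_pt_lim V t (V1 t)) ->
  forall t, derivable_pt_lim (al V) t (- (/ 2) * al V t * (V1 t / V t)).
Proof.
intros Hpos HV t; apply is_derive_Reals; unfold al.
specialize (HV t); apply is_derive_Reals in HV.
pose proof (Hpos t) as Vt.
assert (E : Derive (fun x => V x) t = V1 t) by now apply is_derive_unique.
assert (S0 : 0 < sqrt (3 / V t)) by (apply sqrt_lt_R0, Rdiv_lt_0_compat; lra).
assert (S2 : sqrt (3 / V t) * sqrt (3 / V t) = 3 / V t).
{ apply sqrt_sqrt; left; apply Rdiv_lt_0_compat; lra. }
evar_last.
- apply (is_derive_comp sqrt (fun p => 3 / V p) t).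
  + apply is_derive_Reals, derivable_pt_lim_sqrt, Rdiv_lt_0_compat; lra.
  + auto_derive; [|reflexivity].
    repeat split; [now exists (V1 t) | lra].
- unfold scal; simpl; unfold mult; simpl; rewrite E.
  apply Rmult_eq_reg_r with (2 * sqrt (3 / V t)); [|lra].
  transitivity (- (3 / V t) * (V1 t / V t)).
  + field; lra.
  + rewrite <- S2 at 1; field; lra.
Qed.

Lemma al_lip V V1 V2 V3 M : 0 <= M -> C3 V V1 V2 V3 -> (forall t, 0 < V t) ->
  exists K, 1 <= K /\ lip_on K M (al V).
Proof.
intros HM HV Hpos; destruct (C3_continuity _ _ _ _ HV) as (C0 & C1 & _).
destruct HV as (D1 & _).
pose proof (derive_al V V1 Hpos D1) as D.
apply lip_on_of_derive with (1 := HM) (2 := D).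
intros t; apply continuity_pt_mult; [apply (continuity_pt_scal (al V))|].
- apply derivable_continuous_pt; eexists; apply D.
- apply continuity_pt_div; auto; specialize (Hpos t); lra.
Qed.

(** * The coordinate functions and their derivatives *)

Definition sech (s : R) : R := / cosh s.
Definition lc (q : R) : R := / sqrt (1 + exp (2 * q)).
Definition ls (q : R) : R := exp q * lc q.

Lemma sech_pos s : 0 < sech s.
Proof. apply Rinv_0_lt_compat, cosh_pos. Qed.

Lemma lc_pos q : 0 < lc q.
Proof. apply Rinv_0_lt_compat, sqrt_lt_R0; pose proof (exp_pos (2 * q)); lra. Qed.

Lemma ls_pos q : 0 < ls q.
Proof. apply Rmult_lt_0_compat; [apply exp_pos | apply lc_pos]. Qed.

Lemma lc_sq q : lc q ^ 2 = 1 - sg q.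
Proof.
unfold lc, sg; pose proof (exp_pos (2 * q)).
rewrite pow_inv, pow2_sqrt by lra; field; lra.
Qed.

Lemma ls_sq q : ls q ^ 2 = sg q.
Proof.
unfold ls; rewrite Rpow_mult_distr, lc_sq; unfold sg.
replace (exp (2 * q)) with (exp q ^ 2) by (rewrite exp_pow; f_equal; simpl; ring).
pose proof (exp_pos q); field; nra.
Qed.

Lemma derive_sech s : derivable_pt_lim sech s (- tanh s * sech s).
Proof.
pose proof (cosh_pos s).
replace (- tanh s * sech s) with (- sinh s / (cosh s) ^ 2)
  by (unfold tanh, sech; field; lra).
apply is_derive_Reals, is_derive_inv; [|lra].
apply is_derive_Reals, derivable_pt_lim_cosh.
Qed.

Lemma derive_lc q : derivable_pt_lim lc q (- lc q * sg q).
Proof.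
pose proof (exp_pos (2 * q)).
assert (S0 : 0 < sqrt (1 + exp (2 * q))) by (apply sqrt_lt_R0; lra).
assert (S2 : sqrt (1 + exp (2 * q)) * sqrt (1 + exp (2 * q)) = 1 + exp (2 * q)).
{ apply sqrt_sqrt; lra. }
apply is_derive_Reals; unfold lc; auto_derive; [split; [lra|split; [lra|easy]]|].
unfold sg; set (r := sqrt _) in *; rewrite <- S2; field; lra.
Qed.

Lemma derive_ls q : derivable_pt_lim ls q (ls q * (1 - sg q)).
Proof.
replace (ls q * (1 - sg q)) with (exp q * lc q + exp q * (- lc q * sg q))
  by (unfold ls; ring).
apply derivable_pt_lim_mult; [apply derivable_pt_lim_exp | apply derive_lc].
Qed.

Lemma pos_sq_le1 x : 0 < x -> x ^ 2 <= 1 -> Rabs x <= 1.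
Proof. intros; apply Rabs_le; nra. Qed.

Lemma sech_unit_lip : unit_lip sech.
Proof.
assert (B : forall t, Rabs (sech t) <= 1).
{ intros t; apply pos_sq_le1; [apply sech_pos|].
  unfold sech; rewrite sech_tanh_sq; pose proof (pow2_ge_0 (tanh t)); lra. }
apply unit_lip_of_derive with (1 := B) (2 := derive_sech).
intros t; rewrite <- (Rmult_1_l 1); apply Rabs_mul; [|apply B].
pose proof (tanh_bound t); apply Rabs_le; lra.
Qed.

Lemma tanh_unit_lip : unit_lip tanh.
Proof.
split; [|apply tanh_lipschitz].
intros t; pose proof (tanh_bound t); apply Rabs_le; lra.
Qed.

Lemma lc_unit_lip : unit_lip lc.
Proof.
assert (B : forall t, Rabs (lc t) <= 1).
{ intros t; apply pos_sq_le1; [apply lc_pos|].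
  rewrite lc_sq; pose proof (sg_bound t); lra. }
apply unit_lip_of_derive with (1 := B) (2 := derive_lc).
intros t; rewrite <- (Rmult_1_l 1); apply Rabs_mul; [rewrite Rabs_Ropp; apply B|].
pose proof (sg_bound t); apply Rabs_le; lra.
Qed.

Lemma ls_unit_lip : unit_lip ls.
Proof.
assert (B : forall t, Rabs (ls t) <= 1).
{ intros t; apply pos_sq_le1; [apply ls_pos|].
  rewrite ls_sq; pose proof (sg_bound t); lra. }
apply unit_lip_of_derive with (1 := B) (2 := derive_ls).
intros t; rewrite <- (Rmult_1_l 1); apply Rabs_mul; [apply B|].
pose proof (sg_bound t); apply Rabs_le; lra.
Qed.

Lemma sin_unit_lip : unit_lip sin.
Proof.
apply unit_lip_of_derive with cos; intros t.
- apply Rabs_le, SIN_bound.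
- apply derivable_pt_lim_sin.
- apply Rabs_le, COS_bound.
Qed.

Lemma cos_unit_lip : unit_lip cos.
Proof.
apply unit_lip_of_derive with (fun t => - sin t); intros t.
- apply Rabs_le, COS_bound.
- apply derivable_pt_lim_cos.
- rewrite Rabs_Ropp; apply Rabs_le, SIN_bound.
Qed.

(** * Existence of backward orbits of the reduced field *)

Definition clamp (a p : R) : R := Rmax (- a) (Rmin a p).

Lemma clamp_id a p : Rabs p <= a -> clamp a p = p.
Proof.
intros H; apply Rabs_le_between in H; unfold clamp.
rewrite Rmin_right, Rmax_right; lra.
Qed.

Lemma clamp_bound a p : 0 <= a -> Rabs (clamp a p) <= a.
Proof.
intros H; unfold clamp, Rmax, Rmin; apply Rabs_le.
destruct (Rle_dec a p); destruct Rle_dec; lra.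
Qed.

Lemma clamp_lip a p p' : Rabs (clamp a p - clamp a p') <= Rabs (p - p').
Proof.
unfold clamp, Rmax, Rmin; apply Rabs_le; unfold Rabs; destruct Rcase_abs;
repeat destruct Rle_dec; lra.
Qed.

(* [phi] moves at speed at most 1, so cutting off the coefficients outside
   [|phi| <= |phi 0| + T] makes the field bounded and globally Lipschitz
   without changing orbits up to time [T]. *)
Lemma orbit_exists g A B s0 q0 p0 T : 0 < g < 2 -> 0 < T ->
  (forall M, 0 <= M -> exists K, 1 <= K /\ lip_on K M A) ->
  (forall M, 0 <= M -> exists K, 1 <= K /\ lip_on K M B) ->
  exists u, ts u 0 = s0 /\ tq u 0 = q0 /\ tp u 0 = p0 /\
    orbit g A B (Rabs p0 + T) T u.
Proof.
intros hg HT HA HB; set (a := Rabs p0 + T).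
assert (Ha : 0 <= a) by (pose proof (Rabs_pos p0); unfold a; lra).
destruct (HA a Ha) as (K1 & HK1 & LA), (HB a Ha) as (K2 & HK2 & LB).
set (K := Rmax K1 K2).
assert (HK : 1 <= K) by (eapply Rle_trans; [exact HK1 | apply Rmax_l]).
apply (lip_on_mono K1 K) in LA; [|apply Rmax_l].
apply (lip_on_mono K2 K) in LB; [|apply Rmax_r].
set (A' := fun p => A (clamp a p)); set (B' := fun p => B (clamp a p)).
assert (cl : forall M f, lip_on K a f -> lip_on K M (fun p => f (clamp a p))).
{ intros M f [H H']; split.
  - intros p _; now apply H, clamp_bound.
  - intros p p' _ _; eapply Rle_trans; [apply H'; now apply clamp_bound|].
    apply Rmult_le_compat_l; [lra | apply clamp_lip]. }
assert (LA' : forall M, lip_on K M A') by (intros; now apply cl).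
assert (LB' : forall M, lip_on K M B') by (intros; now apply cl).
(* The index type is [nat]: components 0, 1 and 2 are [s], [q] and [phi], and all later ones repeat
   the equation and the initial value of [phi]. *)
set (F := fun (x : nat -> R) (i : nat) => match i with
  | O => - fs g A' B' (x 0%nat) (x 1%nat) (x 2%nat)
  | 1%nat => - fq g A' B' (x 0%nat) (x 1%nat) (x 2%nat)
  | _ => - fp (x 0%nat) (x 1%nat) (x 2%nat) end).
destruct (global_solution nat F (9 * K) (3 * K)
  (fun i => match i with O => s0 | 1%nat => q0 | _ => p0 end)) as (u & U0 & Du).
- lra.
- lra.
- intros x i; set (M := Rabs (x 2%nat)).
  assert (X1 := fs_bound g A' B' K M hg HK (LA' M) (LB' M)
    (x 0%nat) (x 1%nat) (x 2%nat) (Rle_refl _)).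
  assert (X2 := fq_bound g A' B' K M hg HK (LA' M) (LB' M)
    (x 0%nat) (x 1%nat) (x 2%nat) (Rle_refl _)).
  assert (X3 := fp_bound (x 0%nat) (x 1%nat) (x 2%nat)).
  destruct i as [|[|i]]; unfold F; rewrite Rabs_Ropp; lra.
- intros e x y Hxy i; set (M := Rmax (Rabs (x 2%nat)) (Rabs (y 2%nat))).
  assert (Mx : Rabs (x 2%nat) <= M) by apply Rmax_l.
  assert (My : Rabs (y 2%nat) <= M) by apply Rmax_r.
  assert (X1 := fs_lip g A' B' K M hg HK (LA' M) (LB' M)
    (x 0%nat) (x 1%nat) (x 2%nat) (y 0%nat) (y 1%nat) (y 2%nat) Mx My).
  assert (X2 := fq_lip g A' B' K M (LA' M) (LB' M)
    (x 0%nat) (x 1%nat) (x 2%nat) (y 0%nat) (y 1%nat) (y 2%nat) Mx My).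
  assert (X3 := fp_lip (x 0%nat) (x 1%nat) (x 2%nat) (y 0%nat) (y 1%nat) (y 2%nat)).
  pose proof (Hxy 0%nat) as E0; pose proof (Hxy 1%nat) as E1; pose proof (Hxy 2%nat) as E2.
  assert (He : 0 <= e) by (eapply Rle_trans; [apply Rabs_pos | exact E0]).
  assert (N : forall v w, Rabs (- v - - w) = Rabs (v - w)).
  { intros v w; replace (- v - - w) with (- (v - w)) by ring; apply Rabs_Ropp. }
  destruct i as [|[|i]]; unfold F; rewrite N.
  + eapply Rle_trans; [exact X1|].
    replace (9 * K * e) with (3 * K * (3 * e)) by ring.
    apply Rmult_le_compat_l; lra.
  + eapply Rle_trans; [exact X2|].
    apply Rle_trans with (2 * K * (2 * e)); [apply Rmult_le_compat_l; lra | nra].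
  + eapply Rle_trans; [exact X3|]; nra.
- exists (Traj (fun t => u t 0%nat) (fun t => u t 1%nat) (fun t => u t 2%nat)).
  cbn [ts tq tp]; split; [apply U0|]; split; [apply U0|]; split; [apply U0|].
  intros t Ht; cbn [ts tq tp].
  assert (Hp : Rabs (u t 2%nat) <= a).
  { replace (u t 2%nat) with (p0 + (u t 2%nat - p0)) by ring.
    unfold a; apply Rabs_tri; [apply Rle_refl|].
    apply Rle_trans with (1 * Rabs (t - 0)); [|rewrite Rminus_0_r, Rabs_pos_eq; lra].
    rewrite <- (U0 2%nat).
    apply (lipschitz_of_derive (fun r => u r 2%nat) (fun r => F (u r) 2%nat)).
    - intros r; rewrite Rmin_left, Rmax_right by lra; intros Hr; apply Du; lra.
    - intros r _; unfold F; rewrite Rabs_Ropp; apply fp_bound. }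
  pose proof (Du t 0%nat ltac:(lra)) as D0.
  pose proof (Du t 1%nat ltac:(lra)) as D1.
  pose proof (Du t 2%nat ltac:(lra)) as D2.
  unfold F, fs, fq, A', B' in D0, D1; rewrite (clamp_id _ _ Hp) in D0, D1.
  repeat split; assumption.
Qed.

(** * Back to the constrained system *)

Lemma left_lim_rev f l : derivable_pt_lim f 0 l ->
  left_lim (fun tau => f (- tau)) 0 (f 0).
Proof.
intros Hf; assert (C : continuity_pt f 0) by (apply derivable_continuous_pt; now exists l).
intros eps He; destruct (C eps He) as (d & Hd & H); exists d; split; [easy|].
intros tau Ht; apply (H (- tau)); split; [split; [easy | lra]|].
simpl; unfold R_dist; rewrite Rabs_pos_eq; lra.
Qed.

Lemma derive_eq f t l l' : derivable_pt_lim f t l -> l = l' ->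
  derivable_pt_lim f t l'.
Proof. now intros H <-. Qed.

Lemma derive_rev f tau l : derivable_pt_lim f (- tau) (- l) ->
  derivable_pt_lim (fun t => f (- t)) tau l.
Proof.
intros Hf; replace l with (- l * - (1)) by ring.
apply (derivable_pt_lim_comp Ropp f); [|easy].
apply (derivable_pt_lim_opp id), derivable_pt_lim_id.
Qed.

Lemma orbit_weaken g A B M M' T T' u : orbit g A B M T u -> T' <= T ->
  (forall t, 0 <= t <= T' -> Rabs (tp u t) <= M') -> orbit g A B M' T' u.
Proof.
intros Hu HT HM t Ht; destruct (Hu t) as (D1 & D2 & D3 & _); [lra|]; auto.
Qed.

Section Model.
Variables (g : R) (V V1 chi chi1 : R -> R).
Hypotheses (hV : forall t, 0 < V t) (hV1 : forall t, derivable_pt_lim V t (V1 t)).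

Let A p := / sqrt 6 * (V1 p / V p).
Let B p := (4 - 3 * g) / (2 * sqrt 6) * (chi1 p / chi p).

Lemma sqrt23_sqrt6 : sqrt (2 / 3) = 2 / sqrt 6.
Proof.
assert (0 < sqrt 6) by (apply sqrt_lt_R0; lra).
apply Rmult_eq_reg_r with (sqrt 6); [|lra].
rewrite <- sqrt_mult by lra.
replace (2 / 3 * 6) with (2 * 2) by field; rewrite sqrt_square by lra; field; lra.
Qed.

(** Signs are reversed because [t] stands for [- tau]. The point enters through equations, so that
    the algebra deals with plain variables. Apart from one overall factor [x] or [z], the system
    contains [x] and [z] only through squares, which [X2] and [Z2] express by [y], [sg q] and
    [V p]. *)
Lemma lift_derive u t s q p : s = ts u t -> q = tq u t -> p = tp u t ->
  derivable_pt_lim (ts u) t (- fs g A B s q p) ->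
  derivable_pt_lim (tq u) t (- fq g A B s q p) ->
  derivable_pt_lim (tp u) t (- fp s q p) ->
  let x := al V p * (sech s * lc q) in
  let y := tanh s in let z := sech s * ls q in
  derivable_pt_lim (fun t => al V (tp u t) * (sech (ts u t) * lc (tq u t))) t
    (- Fx g x y z p) /\
  derivable_pt_lim (fun t => tanh (ts u t)) t (- Fy g V1 chi chi1 x y z p) /\
  derivable_pt_lim (fun t => sech (ts u t) * ls (tq u t)) t (- Fz g chi chi1 x y z p) /\
  derivable_pt_lim (tp u) t (- Fph x y z p).
Proof.
intros Es Eq Ep Ds Dq Dp x y z.
assert (R6 : 0 < sqrt 6) by (apply sqrt_lt_R0; lra).
assert (R66 : sqrt 6 ^ 2 = 6) by (apply pow2_sqrt; lra).
assert (HS : derivable_pt_lim (fun t => sech (ts u t)) t (- tanh s * sech s * - fs g A B s q p)).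
{ apply (derivable_pt_lim_comp (ts u) sech); [easy | rewrite Es; apply derive_sech]. }
assert (HC : derivable_pt_lim (fun t => lc (tq u t)) t (- lc q * sg q * - fq g A B s q p)).
{ apply (derivable_pt_lim_comp (tq u) lc); [easy | rewrite Eq; apply derive_lc]. }
assert (HL : derivable_pt_lim (fun t => ls (tq u t)) t (ls q * (1 - sg q) * - fq g A B s q p)).
{ apply (derivable_pt_lim_comp (tq u) ls); [easy | rewrite Eq; apply derive_ls]. }
assert (HT : derivable_pt_lim (fun t => tanh (ts u t)) t ((1 - tanh s ^ 2) * - fs g A B s q p)).
{ apply (derivable_pt_lim_comp (ts u) tanh); [easy|].
  rewrite Es; apply is_derive_Reals, is_derive_tanh. }
assert (HV : derivable_pt_lim (fun t => al V (tp u t)) t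
   (- (/ 2) * al V p * (V1 p / V p) * - fp s q p)).
{ apply (derivable_pt_lim_comp (tp u) (al V)); [easy|].
  rewrite Ep; now apply derive_al. }
assert (Z2 : z ^ 2 = (1 - y ^ 2) * sg q).
{ unfold z; rewrite Rpow_mult_distr, ls_sq; unfold sech; now rewrite sech_tanh_sq. }
assert (X2 : x ^ 2 = 3 / V p * ((1 - y ^ 2) * (1 - sg q))).
{ unfold x; rewrite !Rpow_mult_distr, lc_sq; unfold sech; rewrite sech_tanh_sq.
  unfold al; rewrite pow2_sqrt; [easy|]. left; apply Rdiv_lt_0_compat; [lra | easy]. }
pose proof (hV p) as Vp.
set (k := chi1 p / chi p) in *; set (l := V1 p / V p) in *.
assert (EA : A p = / sqrt 6 * l) by easy.
assert (EB : B p = (4 - 3 * g) / (2 * sqrt 6) * k) by easy.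
repeat split.
- eapply derive_eq.
  + exact (derivable_pt_lim_mult _ _ _ _ _ HV
      (derivable_pt_lim_mult _ _ _ _ _ HS HC)).
  + unfold mult_fct; rewrite <- Es, <- Eq, <- Ep.
    (* The bracket is the logarithmic derivative of [x]: the terms come from [al V], [sech] and
       [lc]. *)
    transitivity (- (x * (- (/ 2) * l * fp s q p - y * fs g A B s q p - sg q * fq g A B s q p))).
    * unfold x, y; ring.
    * unfold Fx; rewrite Z2; unfold fp, fs, fq; fold y.
      rewrite EA, EB, sqrt23_sqrt6; field; lra.
- eapply derive_eq; [exact HT|].
  fold y; unfold Fy; fold k; rewrite X2, Z2.
  replace (3 / V p * ((1 - y ^ 2) * (1 - sg q)) * V1 p / (3 * sqrt 6))
    with ((1 - y ^ 2) * (1 - sg q) * (l / sqrt 6)) by (unfold l; field; lra).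
  unfold fs; fold y; rewrite EA, EB; field; lra.
- eapply derive_eq.
  + exact (derivable_pt_lim_mult _ _ _ _ _ HS HL).
  + unfold mult_fct; rewrite <- Es, <- Eq.
    transitivity (- (z * (- y * fs g A B s q p + (1 - sg q) * fq g A B s q p))).
    * unfold z, y; ring.
    * unfold Fz; rewrite Z2; fold k; unfold fs, fq; fold y.
      rewrite EA, EB; field; lra.
- exact Dp.
Qed.

Lemma interior_coordinates x y z p : 0 < x -> 0 < z ->
  y ^ 2 + z ^ 2 + 1 / 3 * x ^ 2 * V p = 1 ->
  exists s q, x = al V p * (sech s * lc q) /\ y = tanh s /\ z = sech s * ls q.
Proof.
intros Hx Hz E; pose proof (hV p) as Vp.
set (w := 1 / 3 * x ^ 2 * V p) in *.
assert (Hw : 0 < w).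
{ unfold w; apply Rmult_lt_0_compat; [|easy].
  apply Rmult_lt_0_compat; [lra | now apply pow_lt]. }
assert (Hz2 : 0 < z ^ 2) by now apply pow_lt.
assert (Hy : -1 < y < 1) by nra.
(* [s] is the inverse hyperbolic tangent of [y], and [exp q] is [z / sqrt w]. The identities for [x]
   and [z] are then checked on squares, all factors being positive. *)
set (s := / 2 * ln ((1 + y) / (1 - y))); set (q := / 2 * ln (z ^ 2 / w)).
assert (Ty : tanh s = y).
{ assert (E2 : exp s ^ 2 = (1 + y) / (1 - y)).
  { rewrite exp_pow; replace (INR 2 * s) with (ln ((1 + y) / (1 - y)))
      by (unfold s; simpl; field).
    apply exp_ln, Rdiv_lt_0_compat; lra. }
  pose proof (exp_pos s).
  unfold tanh, sinh, cosh; rewrite exp_Ropp.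
  transitivity ((exp s ^ 2 - 1) / (exp s ^ 2 + 1)).
  - field; split; nra.
  - rewrite E2; field; lra. }
assert (Sq : sg q = z ^ 2 / (w + z ^ 2)).
{ unfold sg; replace (2 * q) with (ln (z ^ 2 / w)) by (unfold q; field).
  rewrite exp_ln by now apply Rdiv_lt_0_compat.
  field; lra. }
assert (S2 : sech s ^ 2 = w + z ^ 2).
{ unfold sech; rewrite sech_tanh_sq, Ty; lra. }
pose proof (sech_pos s); pose proof (lc_pos q); pose proof (ls_pos q).
assert (Hal : 0 < al V p) by (apply sqrt_lt_R0, Rdiv_lt_0_compat; lra).
assert (inj : forall a b, 0 < a -> 0 < b -> a ^ 2 = b ^ 2 -> a = b).
{ intros a b Ha Hb Hab; apply Rsqr_inj; try lra; unfold Rsqr; nra. }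
exists s, q; repeat split; [|easy|]; apply inj; auto.
- repeat apply Rmult_lt_0_compat; auto.
- rewrite !Rpow_mult_distr, S2, lc_sq, Sq; unfold al.
  rewrite pow2_sqrt by (left; apply Rdiv_lt_0_compat; lra).
  replace (x ^ 2) with (3 / V p * w) by (unfold w; field; lra).
  field; lra.
- now apply Rmult_lt_0_compat.
- rewrite Rpow_mult_distr, S2, ls_sq, Sq; field; lra.
Qed.

(** [sech], [lc] and [ls] never vanish, so the faces need angles: [a] is [acos y], at most
    [PI <= 4], and [b] selects the face, [PI / 2] for [x = 0] and 0 for [z = 0]. *)
Lemma boundary_coordinates x y z p : 0 <= x -> 0 <= z -> x = 0 \/ z = 0 ->
  y ^ 2 + z ^ 2 + 1 / 3 * x ^ 2 * V p = 1 ->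
  exists a b, Rabs a <= 4 /\ (b = PI / 2 \/ b = 0) /\
    x = al V p * (sin a * cos b) /\ y = cos a /\ z = sin a * sin b.
Proof.
intros Hx Hz Hxz E; pose proof (hV p) as Vp.
assert (Hw : 0 <= 1 / 3 * x ^ 2 * V p).
{ apply Rmult_le_pos; [|lra]; apply Rmult_le_pos; [lra | apply pow2_ge_0]. }
pose proof (pow2_ge_0 z).
assert (Hy : -1 <= y <= 1) by nra.
pose proof (acos_bound y) as Ha; pose proof PI_4.
assert (Ha4 : Rabs (acos y) <= 4) by (apply Rabs_le; lra).
assert (Hsin : sin (acos y) = sqrt (1 - y ^ 2)).
{ rewrite sin_acos by easy; f_equal; unfold Rsqr; ring. }
exists (acos y).
destruct Hxz as [-> | ->].
- exists (PI / 2); rewrite cos_PI2, sin_PI2, cos_acos, Hsin by easy.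
  repeat split; auto; try ring.
  replace (1 - y ^ 2) with (z ^ 2) by lra; rewrite sqrt_pow2; lra.
- exists 0; rewrite cos_0, sin_0, cos_acos, Hsin by easy.
  repeat split; auto; try ring.
  rewrite Rmult_1_r; unfold al; rewrite <- sqrt_mult.
  + replace (3 / V p * (1 - y ^ 2)) with (x ^ 2); [now rewrite sqrt_pow2|].
    replace (1 - y ^ 2) with (1 / 3 * x ^ 2 * V p) by lra; field; lra.
  + left; apply Rdiv_lt_0_compat; lra.
  + nra.
Qed.

(** The hypothesis bounds [phi] on every backward solution through the point, in particular on the
    lift of the orbit given by [orbit_exists]. The bound of that orbit, which grows with [T], is
    thereby replaced by [M]. *)
Lemma bounded_past_orbits s0 q0 p0 M : 0 < g < 2 ->
  (forall M, 0 <= M -> exists K, 1 <= K /\ lip_on K M A) ->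
  (forall M, 0 <= M -> exists K, 1 <= K /\ lip_on K M B) ->
  Rabs p0 <= M ->
  (forall t t' X Y Z P, t < t' < 0 -> solves g V1 chi chi1 X Y Z P t 0 ->
    left_lim X 0 (al V p0 * (sech s0 * lc q0)) -> left_lim Y 0 (tanh s0) ->
    left_lim Z 0 (sech s0 * ls q0) -> left_lim P 0 p0 -> Rabs (P t') <= M) ->
  forall T, 0 < T -> exists u, orbit g A B M T u /\
    ts u 0 = s0 /\ tq u 0 = q0 /\ tp u 0 = p0.
Proof.
intros hg HA HB Hp0 Hbd T HT.
(* The extra unit of time puts [- T] inside the open interval on which the lift is a solution. *)
destruct (orbit_exists g A B s0 q0 p0 (T + 1) hg ltac:(lra) HA HB)
  as (u & U1 & U2 & U3 & Hu).
exists u; split; [|easy].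
apply orbit_weaken with (1 := Hu); [lra|].
intros t Ht; destruct (Req_dec t 0) as [->|Nt]; [now rewrite U3|].
assert (Hd : forall t, 0 <= t <= T + 1 -> _) by
  (intros r Hr; destruct (Hu r Hr) as (D1 & D2 & D3 & _);
   exact (lift_derive u r _ _ _ eq_refl eq_refl eq_refl D1 D2 D3)).
cbv zeta in Hd.
rewrite <- (Ropp_involutive t).
apply (Hbd (- (T + 1)) (- t)
  (fun tau => al V (tp u (- tau)) * (sech (ts u (- tau)) * lc (tq u (- tau))))
  (fun tau => tanh (ts u (- tau)))
  (fun tau => sech (ts u (- tau)) * ls (tq u (- tau)))
  (fun tau => tp u (- tau))).
- lra.
- intros tau Htau; destruct (Hd (- tau)) as (D1 & D2 & D3 & D4); [lra|].
  repeat split; cbv beta.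
  + now apply (derive_rev (fun t => al V (tp u t) * (sech (ts u t) * lc (tq u t)))).
  + now apply (derive_rev (fun t => tanh (ts u t))).
  + now apply (derive_rev (fun t => sech (ts u t) * ls (tq u t))).
  + now apply (derive_rev (tp u)).
- rewrite <- U1, <- U2, <- U3; destruct (Hd 0) as (D1 & _); [lra|].
  exact (left_lim_rev _ _ D1).
- rewrite <- U1; destruct (Hd 0) as (_ & D2 & _); [lra|].
  exact (left_lim_rev _ _ D2).
- rewrite <- U1, <- U2; destruct (Hd 0) as (_ & _ & D3 & _); [lra|].
  exact (left_lim_rev _ _ D3).
- rewrite <- U3; destruct (Hd 0) as (_ & _ & _ & D4); [lra|].
  exact (left_lim_rev _ _ D4).
Qed.

End Model.

Theorem theorem1 (g : R) (V V1 V2 V3 chi chi1 chi2 chi3 : R -> R)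
  (hg0 : 0 < g) (hg2 : g < 2) (hg43 : g <> 4/3)
  (hV : C3 V V1 V2 V3) (hchi : C3 chi chi1 chi2 chi3)
  (hVpos : forall t, 0 < V t) (hchipos : forall t, 0 < chi t) :
  H3_null (fun x y z ph =>
    in_Sigma V x y z ph /\ ~ phi_unbounded_past g V1 chi chi1 x y z ph).
Proof.
set (A := fun p => / sqrt 6 * (V1 p / V p)).
set (B := fun p => (4 - 3 * g) / (2 * sqrt 6) * (chi1 p / chi p)).
assert (hg : 0 < g < 2) by easy.
assert (HA : forall M, 0 <= M -> exists K, 1 <= K /\ lip_on K M A)
  by (intros; now apply log_derivative_lip with V2 V3).
assert (HB : forall M, 0 <= M -> exists K, 1 <= K /\ lip_on K M B)
  by (intros; now apply log_derivative_lip with chi2 chi3).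
assert (hV1 : forall t, derivable_pt_lim V t (V1 t)) by apply hV.
(* The bound is [INR n + 1] because the contraction argument needs [M >= 1]; for the faces it is
   [INR n + 4], so that the angle [a] is within the bound for every [n]. *)
set (E := fun n s q p => (Rabs s <= INR n + 1 /\ Rabs q <= INR n + 1 /\
  forall T, 0 < T -> exists u, orbit g A B (INR n + 1) T u /\
      ts u 0 = s /\ tq u 0 = q /\ tp u 0 = p)).
set (Bd := fun (b : R) n a b' p => Rabs a <= INR n + 4 /\ b' = b /\ Rabs p <= INR n + 4).
set (bdry := fun (b : R) (n : nat) x y z p => exists a b', Bd b n a b' p /\
  x = al V p * (sin a * cos b') /\ y = cos a /\ z = sin a * sin b').
apply weak_null_H3_null.
(* The inner index distinguishes the interior (0), the face [x = 0] (1) and the face [z = 0] (2 and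
   beyond), so that the same countable union lemma applies twice. *)
apply weak_null_subset with (fun x y z p => exists n, exists i,
  match i with
  | O => exists s q, E n s q p /\
      x = al V p * (sech s * lc q) /\ y = tanh s /\ z = sech s * ls q
  | 1%nat => bdry (PI / 2) n x y z p
  | _ => bdry 0 n x y z p
  end).
2:{ apply weak_null_union; intros n; pose proof (pos_INR n).
    apply (weak_null_union (fun i x y z p => match i with
      | O => exists s q, E n s q p /\
          x = al V p * (sech s * lc q) /\ y = tanh s /\ z = sech s * ls q
      | 1%nat => bdry (PI / 2) n x y z p
      | _ => bdry 0 n x y z p end)).
    assert (HBd : forall b, weak_null (bdry b n)).
    { intros b; destruct (al_lip V V1 V2 V3 (INR n + 4)) as (K & HK & HL); auto; [lra|].
      apply (warped_null (Bd b n) (al V) sin cos cos sin K (INR n + 4));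
        auto using sin_unit_lip, cos_unit_lip.
      - now intros a b' p (_ & _ & ?).
      - apply planar_fnull; lra. }
    intros [|[|i]]; [|apply HBd|apply HBd].
    set (M := INR n + 1) in *; assert (HM : 1 <= M) by (unfold M; lra).
    destruct (al_lip V V1 V2 V3 M) as (K & HK & HL); auto; [lra|].
    destruct (HA M) as (K1 & HK1 & LA); [lra|].
    destruct (HB M) as (K2 & HK2 & LB); [lra|].
    apply (warped_null (E n) (al V) sech tanh lc ls K M);
      auto using sech_unit_lip, tanh_unit_lip, lc_unit_lip, ls_unit_lip.
    - intros s q p (_ & _ & HT); destruct (HT 1) as (u & Hu & _ & _ & <-); [lra|].
      apply (Hu 0); lra.
    - apply (bounded_past_fnull g A B (Rmax K1 K2) M); try lra.
      + eapply Rle_trans; [exact HK1 | apply Rmax_l].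
      + eapply lip_on_mono; [apply Rmax_l | exact LA].
      + eapply lip_on_mono; [apply Rmax_r | exact LB]. }
intros x y z p [(Hx & Hz & HS) Hub].
destruct (Rle_lt_or_eq_dec 0 x Hx) as [Hx'|Hx'].
1: destruct (Rle_lt_or_eq_dec 0 z Hz) as [Hz'|Hz'].
- apply not_all_ex_not in Hub; destruct Hub as [M Hub].
  destruct (interior_coordinates V hVpos x y z p Hx' Hz' HS) as (s & q & -> & -> & ->).
  destruct (nat_above (Rabs M + Rabs p + Rabs s + Rabs q)) as (n & _ & Hn & _).
  { pose proof (Rabs_pos M); pose proof (Rabs_pos p); pose proof (Rabs_pos s);
    pose proof (Rabs_pos q); lra. }
  pose proof (Rabs_pos M); pose proof (Rabs_pos p); pose proof (Rabs_pos s);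
  pose proof (Rabs_pos q); pose proof (Rle_abs M).
  exists n, 0%nat, s, q; repeat split; try lra.
  apply bounded_past_orbits; auto; [lra|].
  intros t t' X Y Z P Ht Hsol LX LY LZ LP.
  apply Rnot_lt_le; intros Hlt; apply Hub.
  exists t, t', X, Y, Z, P; repeat split; auto; try apply Ht; try (now apply Hsol); lra.
- destruct (boundary_coordinates V hVpos x y z p Hx Hz ltac:(auto) HS)
    as (a & b & Ha & Hb & Exyz).
  destruct (nat_above (Rabs p) (Rabs_pos p)) as (n & _ & Hn & _); pose proof (pos_INR n).
  destruct Hb as [-> | ->]; [exists n, 1%nat | exists n, 2%nat];
  eexists; eexists; (split; [|exact Exyz]); repeat split; lra.
- destruct (boundary_coordinates V hVpos x y z p Hx Hz ltac:(auto) HS)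
    as (a & b & Ha & Hb & Exyz).
  destruct (nat_above (Rabs p) (Rabs_pos p)) as (n & _ & Hn & _); pose proof (pos_INR n).
  destruct Hb as [-> | ->]; [exists n, 1%nat | exists n, 2%nat];
  eexists; eexists; (split; [|exact Exyz]); repeat split; lra.
Qed.
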